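(* Let $d,m\in\mathbb N$, let $\odot$ be a u.a.u.-product in $\mathbf{AlgP}_{d,m}$ and let $V=\bigoplus_{n=1}^\infty V^{(n)}$ be an $\mathbb N$-graded vector space. Then the bialgebra $\mathcal L_\odot(\mathrm T(V))$ is an $\mathbb N_0$-graded Hopf algebra.
   Context: Algebras are complex associative, not necessarily unital. $W^{*d}:=(W^* )^d=(W^d)^*$; $\varphi\circ j$ is taken componentwise. $A_1\sqcup A_2$ is the free product (coproduct of non-unital algebras) with embeddings $\iota_1,\iota_2$; $j_1\,\underline\sqcup\,j_2=(\iota_1\circ j_1)\sqcup(\iota_2\circ j_2)$. Category $\mathbf{AlgP}_{d,m}$: objects $(A,(A^{(1)},\dots,A^{(m)}),\varphi)$ with $A$ an algebra, $A^{(l)}$ subalgebras freely generating $A$ (the canonical map $A^{(1)}\sqcup\dots\sqcup A^{(m)}\to A$ is bijective), $\varphi\in A^{*d}$; morphisms: algebra homomorphisms $j:B\to A$ with $j(B^{(l)})\subset A^{(l)}$ and $\psi=\varphi\circ j$. A universal product $\odot$ assigns to two objects an element $\varphi_1\odot\varphi_2\in(A_1\sqcup A_2)^{*d}$, where $A_1\sqcup A_2$ carries the subalgebras $A_1^{(l)}\sqcup A_2^{(l)}$, such that $(\varphi_1\odot\varphi_2)\circ(j_1\,\underline\sqcup\,j_2)=(\varphi_1\circ j_1)\odot(\varphi_2\circ j_2)$ for all algebra homomorphisms $j_i:B_i\to A_i$ with $j_i(B_i^{(l)})\subset A_i^{(l)}$. It is a u.a.u.-product if moreover $(\varphi_1\odot\varphi_2)\circ\iota_i=\varphi_i$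 ($i=1,2$) and $(\varphi_1\odot\varphi_2)\odot\varphi_3=\varphi_1\odot(\varphi_2\odot\varphi_3)$. (Universal products are assumed non-degenerate: not identically zero on all alternating products of length $>1$.) $\mathrm T(V)=\bigoplus_{k\ge1}V^{\otimes k}$ is the tensor algebra without unit, with the algebra homomorphism $\Delta:\mathrm T(V)\to\mathrm T(V)\sqcup\mathrm T(V)$, $\Delta v=\iota_1v+\iota_2v$ ($v\in V$); it inherits from $V$ a unique grading making it an $\mathbb N$-graded algebra with $V$ having its given grading. $\mathrm D:=\mathrm T(V)^{\sqcup m}$ is the free product of $m$ copies of $\mathrm T(V)$ (its $m$ distinguished subalgebras), and $\Delta^{\sqcup m}:\mathrm D\to\mathrm D\sqcup\mathrm D$ acts as $\Delta$ on each copy (from the $l$-th copy to the free product of the two $l$-th copies). $\mathrm S(W)$ is the unital symmetric tensor algebra of $W$; a linear map $R$ from $W$ to a commutative unital algebra extends uniquely to a unital homomorphism $\mathrm S(R)$; in particular $\mathrm S(\varphi):\mathrm S(W)\to\mathbb C$ for $\varphi\in W^*$. For algebras $A_1,A_2$ with $m$ freely generating subalgebras there is a unique map $\sigma_{A_1,A_2}:(A_1\sqcup A_2)^d\to\mathrm S(A_1^d)\otimes\mathrm S(A_2^d)$ with $\varphi_1\odot\varphi_2=(\mathrm S(\varphi_1)\otimes\mathrm S(\varphi_2))\circ\sigma_{A_1,A_2}$ for all $\varphi_i\in A_i^{*d}$. $\mathcal L_\odot(\mathrm T(V))$ is the commutative bialgebra $\mathrm S(\mathrm D^d)$ with comultiplication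 $\mathrm S(\sigma_{\mathrm D,\mathrm D}\circ\Delta^{\sqcup m})$ ($\Delta^{\sqcup m}$ applied componentwise on $\mathrm D^d$) and counit $\mathrm S(0)$. Its grading is the natural one: $\mathrm D$ is graded as a free product, $\mathrm D^d$ as a direct sum, and $\mathrm S(\mathrm D^d)$ as the symmetric algebra of an $\mathbb N$-graded space. An $\mathbb N_0$-graded bialgebra (Hopf algebra) $B=\bigoplus_{n\ge0}B^{(n)}$ is a bialgebra (Hopf algebra) graded as an algebra whose comultiplication maps $B^{(n)}$ into $\bigoplus_{k=0}^nB^{(k)}\otimes B^{(n-k)}$. *)

(* Defs.v *)
From HB Require Import structures.
From mathcomp Require Import all_boot all_order all_algebra.
From mathcomp Require Import boolp classical_sets reals complex.

Set Implicit Arguments.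
Unset Strict Implicit.
Unset Printing Implicit Defensive.

Import GRing.Theory.

(* None of the infinite-dimensional constructions involved (tensor products,
   tensor and symmetric algebras, free products) is available in the
   libraries.  All of them are built below as presentations: formal linear
   combinations modulo the least congruence containing given relations.
   Homomorphisms out of them are given by their universal properties. *)

Local Open Scope ring_scope.
Local Open Scope quotient_scope.

Section LinearPresentation.
Variable K : fieldType.

(* Formal linear combinations of elements of X. *)
Inductive lterm (X : Type) : Type :=
| LZero
| LGen of X
| LAdd of lterm X & lterm X
| LScale of K & lterm X.

Arguments LZero {X}.

Fixpoint leval (X : Type) (U : lmodType K) (f : X -> U) (t : lterm X) : U :=
  match t with
  | LZero => 0
  | LGen x => f x
  | LAdd t u => leval f t + leval f u
  | LScale c t => c *: leval f t
  end.

Lemma leval0 X (U : lmodType K) (f : X -> U) : leval f LZero = 0.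
Proof. by []. Qed.
Lemma levalG X (U : lmodType K) (f : X -> U) x : leval f (LGen x) = f x.
Proof. by []. Qed.
Lemma levalD X (U : lmodType K) (f : X -> U) t u :
  leval f (LAdd t u) = leval f t + leval f u.
Proof. by []. Qed.
Lemma levalZ X (U : lmodType K) (f : X -> U) c t :
  leval f (LScale c t) = c *: leval f t.
Proof. by []. Qed.
Definition levalE := (leval0, levalG, levalD, levalZ).

Fixpoint lsubst (X Y : Type) (f : X -> Y) (t : lterm X) : lterm Y :=
  match t with
  | LZero => LZero
  | LGen x => LGen (f x)
  | LAdd t u => LAdd (lsubst f t) (lsubst f u)
  | LScale c t => LScale c (lsubst f t)
  end.

(* The least congruence that contains Rel and makes the quotient a vector
   space. *)
Inductive lcong (X : Type) (Rel : lterm X -> lterm X -> Prop) :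
  lterm X -> lterm X -> Prop :=
| lc_refl t : lcong Rel t t
| lc_sym t u : lcong Rel t u -> lcong Rel u t
| lc_trans t u v : lcong Rel t u -> lcong Rel u v -> lcong Rel t v
| lc_add t t' u u' :
    lcong Rel t t' -> lcong Rel u u' -> lcong Rel (LAdd t u) (LAdd t' u')
| lc_scale c t t' : lcong Rel t t' -> lcong Rel (LScale c t) (LScale c t')
| lc_addA t u v : lcong Rel (LAdd t (LAdd u v)) (LAdd (LAdd t u) v)
| lc_addC t u : lcong Rel (LAdd t u) (LAdd u t)
| lc_add0 t : lcong Rel (LAdd LZero t) t
| lc_scale0 t : lcong Rel (LScale 0 t) LZero
| lc_scale1 t : lcong Rel (LScale 1 t) t
| lc_scaleA a b t : lcong Rel (LScale a (LScale b t)) (LScale (a * b) t)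
| lc_scaleDr a t u :
    lcong Rel (LScale a (LAdd t u)) (LAdd (LScale a t) (LScale a u))
| lc_scaleDl a b t :
    lcong Rel (LScale (a + b) t) (LAdd (LScale a t) (LScale b t))
| lc_rel t u : Rel t u -> lcong Rel t u.

HB.instance Definition _ (X : Type) := gen_eqMixin (lterm X).
HB.instance Definition _ (X : Type) := gen_choiceMixin (lterm X).

Section Quotient.
Variables (X : Type) (Rel : lterm X -> lterm X -> Prop).

Definition lcongb (t u : lterm X) : bool := `[< lcong Rel t u >].

Lemma lcongb_refl : reflexive lcongb.
Proof. by move=> t; apply/asboolP; exact: lc_refl. Qed.

Lemma lcongb_sym : symmetric lcongb.
Proof.
by move=> t u; apply/asboolP/asboolP; exact: lc_sym.
Qed.

Lemma lcongb_trans : transitive lcongb.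
Proof.
move=> u t v /asboolP tu /asboolP uv; apply/asboolP; exact: lc_trans tu uv.
Qed.

Definition lcong_equiv : equiv_rel (lterm X) :=
  EquivRel lcongb lcongb_refl lcongb_sym lcongb_trans.

(* The vector space generated by X with the linear relations Rel: the free
   vector space on X modulo the span of the differences t - u, Rel t u. *)
Definition lpres : Type := {eq_quot lcong_equiv}.

HB.instance Definition _ := Choice.on lpres.

Definition lpi (t : lterm X) : lpres := \pi_({eq_quot lcong_equiv}) t.
Definition lrepr (p : lpres) : lterm X := repr (p : {eq_quot lcong_equiv}).

Lemma lreprK p : lpi (lrepr p) = p. Proof. exact: reprK. Qed.

Lemma lpiP t u : lpi t = lpi u <-> lcong Rel t u.
Proof.
rewrite /lpi; split=> [/eqP|tu]; first by rewrite eqmodE => /asboolP.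
by apply/eqP; rewrite eqmodE; apply/asboolP.
Qed.

Lemma lrepr_pi t : lcong Rel (lrepr (lpi t)) t.
Proof. by apply/lpiP; rewrite lreprK. Qed.

Let add (p q : lpres) := lpi (LAdd (lrepr p) (lrepr q)).
Let scale (c : K) (p : lpres) := lpi (LScale c (lrepr p)).
Let opp (p : lpres) := scale (-1) p.

Let addE t u : add (lpi t) (lpi u) = lpi (LAdd t u).
Proof. by apply/lpiP; apply: lc_add; apply: lrepr_pi. Qed.

Let scaleE c t : scale c (lpi t) = lpi (LScale c t).
Proof. by apply/lpiP; apply: lc_scale; apply: lrepr_pi. Qed.

Let addA : associative add.
Proof.
move=> p q r; rewrite -[p]lreprK -[q]lreprK -[r]lreprK !addE.
by apply/lpiP; exact: lc_addA.
Qed.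

Let addC : commutative add.
Proof. by move=> p q; apply/lpiP; exact: lc_addC. Qed.

Let add0 : left_id (lpi LZero) add.
Proof. by move=> p; rewrite -[p]lreprK addE; apply/lpiP; exact: lc_add0. Qed.

Let addN : left_inverse (lpi LZero) opp add.
Proof.
move=> p; rewrite -[p]lreprK /opp scaleE addE; apply/lpiP.
apply: lc_trans (lc_scale0 _ (lrepr p)); rewrite -(addNr 1).
apply: lc_trans (lc_sym (lc_scaleDl _ _ _ _)).
by apply: lc_add (lc_refl _ _) (lc_sym (lc_scale1 _ _)).
Qed.

HB.instance Definition _ := GRing.isZmodule.Build lpres addA addC add0 addN.

Let scaleA a b p : scale a (scale b p) = scale (a * b) p.
Proof.
by rewrite -[p]lreprK !scaleE; apply/lpiP; exact: lc_scaleA.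
Qed.

Let scale1 : left_id 1 scale.
Proof.
by move=> p; rewrite -[p]lreprK scaleE; apply/lpiP; exact: lc_scale1.
Qed.

Let scaleDr : right_distributive scale +%R.
Proof.
move=> a p q; rewrite -[p]lreprK -[q]lreprK.
have addrE p' q' : p' + q' = add p' q' by [].
rewrite !addrE addE !scaleE addE.
by apply/lpiP; exact: lc_scaleDr.
Qed.

Let scaleDl p : {morph scale^~ p : a b / a + b}.
Proof.
move=> a b /=; rewrite -[p]lreprK.
have addrE p' q' : p' + q' = add p' q' by [].
rewrite !addrE !scaleE addE.
by apply/lpiP; exact: lc_scaleDl.
Qed.

HB.instance Definition _ :=
  GRing.Zmodule_isLmodule.Build K lpres scaleA scale1 scaleDr scaleDl.

Definition lgen (x : X) : lpres := lpi (LGen x).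

Lemma lpi0 : lpi LZero = 0. Proof. by []. Qed.
Lemma lpiD t u : lpi (LAdd t u) = lpi t + lpi u.
Proof. by rewrite -addE. Qed.
Lemma lpiZ c t : lpi (LScale c t) = c *: lpi t.
Proof. by rewrite -scaleE. Qed.

Lemma lpiE t : lpi t = leval lgen t.
Proof. by elim: t => //= [t <- u <-|c t <-]; rewrite ?lpiD ?lpiZ. Qed.

Lemma lpres_ind (P : lpres -> Prop) :
  P 0 -> (forall x, P (lgen x)) -> (forall p q, P p -> P q -> P (p + q)) ->
  (forall c p, P p -> P (c *: p)) -> forall p, P p.
Proof.
move=> P0 Pg PD PZ p; rewrite -[p]lreprK.
by elim: (lrepr p) => // [t ? u ?|c t ?]; rewrite ?lpiD ?lpiZ; auto.
Qed.

Section Extension.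
Variables (U : lmodType K) (f : X -> U).
Hypothesis f_rel : forall t u, Rel t u -> leval f t = leval f u.

Definition lext_fun (p : lpres) : U := leval f (lrepr p).

Lemma leval_cong t u : lcong Rel t u -> leval f t = leval f u.
Proof.
elim=> //=.
- by move=> ? ? ? _ -> _ ->.
- by move=> ? ? ? ? _ -> _ ->.
- by move=> ? ? ? _ ->.
- by move=> *; rewrite addrA.
- by move=> *; rewrite addrC.
- by move=> *; rewrite add0r.
- by move=> *; rewrite scale0r.
- by move=> *; rewrite scale1r.
- by move=> *; rewrite scalerA.
- by move=> *; rewrite scalerDr.
- by move=> *; rewrite scalerDl.
Qed.

Lemma lext_pi t : lext_fun (lpi t) = leval f t.
Proof. exact/leval_cong/lrepr_pi. Qed.

Lemma lext_linear : linear lext_fun.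
Proof.
move=> c p q; rewrite -[p]lreprK -[q]lreprK -lpiZ -lpiD !lext_pi //=.
Qed.

Definition lext : {linear lpres -> U} :=
  HB.pack lext_fun (GRing.isLinear.Build K lpres U _ lext_fun lext_linear).

Lemma lextE x : lext (lgen x) = f x.
Proof. exact: lext_pi. Qed.

End Extension.

Lemma lpres_hom_eq (U : lmodType K) (f g : {linear lpres -> U}) :
  (forall x, f (lgen x) = g (lgen x)) -> f =1 g.
Proof.
move=> fg; elim/lpres_ind=> [|x|p q fp fq|c p fp]; rewrite ?linear0 //.
  by rewrite !linearD fp fq.
by rewrite !linearZ /= fp.
Qed.

End Quotient.

Lemma leval_lsubst (X Y : Type) (U : lmodType K) (f : X -> Y) (g : Y -> U) t :
  leval g (lsubst f t) = leval (g \o f) t.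
Proof. by elim: t => //= [t -> u ->|c t ->]. Qed.

Lemma eq_leval (X : Type) (U : lmodType K) (f g : X -> U) t :
  f =1 g -> leval f t = leval g t.
Proof. by move=> fg; elim: t => //= [t -> u ->|c t ->]. Qed.

Lemma leval_comp (X : Type) (U W : lmodType K) (f : X -> U)
    (h : {linear U -> W}) t :
  leval (h \o f) t = h (leval f t).
Proof.
elim: t => //= [|t -> u ->|c t ->]; by rewrite ?linear0 ?linearD ?linearZ.
Qed.

(* The product lgen x, lgen y |-> lgen (op x y) for a semigroup X of generators
   and relations that are stable under translations. *)
Section Multiplication.
Variables (X : Type) (op : X -> X -> X) (Rel : lterm X -> lterm X -> Prop).
Hypothesis opA : associative op.
Hypothesis stab_l : forall x t u, Rel t u ->
  lcong Rel (lsubst (op x) t) (lsubst (op x) u).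
Hypothesis stab_r : forall x t u, Rel t u ->
  lcong Rel (lsubst (op^~ x) t) (lsubst (op^~ x) u).

Notation P := (lpres Rel).

Let rtr_rel y t u : Rel t u ->
  leval (fun x => lgen Rel (op x y)) t = leval (fun x => lgen Rel (op x y)) u.
Proof.
move=> tu; have := stab_r y tu; move/lpiP; rewrite !lpiE.
by rewrite !leval_lsubst.
Qed.

Definition lrtr (y : X) : {linear P -> P} := lext (rtr_rel y).

Let lmul_rel p t u : Rel t u ->
  leval (fun y => lrtr y p) t = leval (fun y => lrtr y p) u.
Proof.
move=> tu; elim/lpres_ind: p => [|x|p q fp fq|c p fp].
- have E v : leval (fun y => lrtr y 0) v = 0.
    elim: v => [//|y|v IH w IH'|c v IH]; rewrite levalE.
    + exact: linear0.
    + by rewrite IH IH' addr0.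
    + by rewrite IH scaler0.
  by rewrite !E.
- have E v : leval (fun y => lrtr y (lgen Rel x)) v =
             lpi Rel (lsubst (op x) v).
    rewrite lpiE leval_lsubst; apply: eq_leval => y.
    exact: lextE.
  by rewrite !E; apply/lpiP; exact: stab_l.
- have E v : leval (fun y => lrtr y (p + q)) v =
     leval (fun y => lrtr y p) v + leval (fun y => lrtr y q) v.
    elim: v => [|y|v IH w IH'|c v IH]; rewrite !levalE.
    + by rewrite addr0.
    + exact: linearD.
    + by rewrite IH IH' addrACA.
    + by rewrite IH scalerDr.
  by rewrite !E fp fq.
- have E v : leval (fun y => lrtr y (c *: p)) v =
     c *: leval (fun y => lrtr y p) v.
    elim: v => [|y|v IH w IH'|a v IH]; rewrite !levalE.
    + by rewrite scaler0.
    + exact: linearZ.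
    + by rewrite IH IH' scalerDr.
    + by rewrite IH !scalerA mulrC.
  by rewrite !E fp.
Qed.

Definition lmul (p : P) : {linear P -> P} := lext (lmul_rel p).

Lemma lmul_gen x y : lmul (lgen Rel x) (lgen Rel y) = lgen Rel (op x y).
Proof. by rewrite lextE lextE. Qed.

Lemma lmulDZl c p p' q : lmul (c *: p + p') q = c *: lmul p q + lmul p' q.
Proof.
elim/lpres_ind: q => [|y|q q' Hq Hq'|a q Hq].
- by rewrite !linear0 ?scaler0 addr0.
- by rewrite !lextE linearP.
- by rewrite !(linearD (lmul _)) Hq Hq' scalerDr addrACA.
- by rewrite !(linearZ_LR (lmul _)) Hq scalerDr !scalerA mulrC.
Qed.

Lemma lmulDZr c p p' q : lmul q (c *: p + p') = c *: lmul q p + lmul q p'.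
Proof. exact: linearP. Qed.

Definition lmulr (q : P) : {linear P -> P} :=
  HB.pack (fun p => lmul p q)
    (GRing.isLinear.Build K P P _ (fun p => lmul p q)
       (fun c p p' => lmulDZl c p p' q)).

Lemma lmulA p q r : lmul p (lmul q r) = lmul (lmul p q) r.
Proof.
pose g := lgen Rel.
have H1 x y z : lmul (g x) (lmul (g y) (g z)) = lmul (lmul (g x) (g y)) (g z).
  by rewrite !lmul_gen opA.
have H2 s y z : lmul s (lmul (g y) (g z)) = lmul (lmul s (g y)) (g z).
  exact: (lpres_hom_eq (f := lmulr (lmul (g y) (g z)))
    (g := lmulr (g z) \o lmulr (g y)) (fun x => H1 x y z) s).
have H3 s t z : lmul s (lmul t (g z)) = lmul (lmul s t) (g z).
  exact: (lpres_hom_eq (f := lmul s \o lmulr (g z))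
    (g := lmulr (g z) \o lmul s) (fun y => H2 s y z) t).
exact: (lpres_hom_eq (f := lmul p \o lmul q) (g := lmul (lmul p q))
  (fun z => H3 p q z) r).
Qed.

End Multiplication.
End LinearPresentation.

(* Not necessarily unital associative algebras. *)
HB.mixin Record Lmodule_isNUAlgebra (K : fieldType) A of GRing.Lmodule K A := {
  numul : A -> A -> A;
  numulA : associative numul;
  numulDZl : forall (c : K) (a b x : A),
    numul (c *: a + b) x = c *: numul a x + numul b x;
  numulDZr : forall (c : K) (a b x : A),
    numul x (c *: a + b) = c *: numul x a + numul x b
}.

#[short(type="nualgType")]
HB.structure Definition NUAlgebra (K : fieldType) :=
  {A of Lmodule_isNUAlgebra K A & GRing.Lmodule K A}.

Section NUHom.
Variable K : fieldType.

Record nuhom (A B : nualgType K) := NUHom {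
  nuhom_fun :> A -> B;
  nuhom_linear : linear nuhom_fun;
  nuhomM : forall x y, nuhom_fun (numul x y) = numul (nuhom_fun x) (nuhom_fun y)
}.

HB.instance Definition _ (A B : nualgType K) (f : nuhom A B) :=
  GRing.isLinear.Build K A B _ (nuhom_fun f) (@nuhom_linear A B f).

Lemma nuid_linear (A : nualgType K) : linear (fun x : A => x).
Proof. by []. Qed.
Definition nuid (A : nualgType K) : nuhom A A :=
  NUHom (@nuid_linear A) (fun _ _ => erefl).

Section Comp.
Variables (A B C : nualgType K) (g : nuhom B C) (f : nuhom A B).

Lemma nucomp_linear : linear (fun x => g (f x)).
Proof. by move=> c x y; rewrite !linearP. Qed.
Lemma nucompM x y : g (f (numul x y)) = numul (g (f x)) (g (f y)).
Proof. by rewrite !nuhomM. Qed.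
Definition nucomp : nuhom A C := NUHom nucomp_linear nucompM.
Lemma nucompE x : nucomp x = g (f x). Proof. by []. Qed.
End Comp.

Section NUTheory.
Variable A : nualgType K.
Implicit Types x y z : A.

Lemma numul0l x : numul 0 x = 0.
Proof.
by have := numulDZl (-1) 0 0 x; rewrite scaler0 addr0 => ->;
  rewrite scaleN1r addNr.
Qed.
Lemma numul0r x : numul x 0 = 0.
Proof.
by have := numulDZr (-1) 0 0 x; rewrite scaler0 addr0 => ->;
  rewrite scaleN1r addNr.
Qed.
Lemma numulDl x y z : numul (x + y) z = numul x z + numul y z.
Proof. by rewrite -[x in LHS]scale1r numulDZl scale1r. Qed.
Lemma numulDr x y z : numul x (y + z) = numul x y + numul x z.
Proof. by rewrite -[y in LHS]scale1r numulDZr scale1r. Qed.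
Lemma numulZl c x y : numul (c *: x) y = c *: numul x y.
Proof. by rewrite -[c *: x]addr0 numulDZl numul0l addr0. Qed.
Lemma numulZr c x y : numul x (c *: y) = c *: numul x y.
Proof. by rewrite -[c *: y]addr0 numulDZr numul0r addr0. Qed.
End NUTheory.
End NUHom.

Section SemigroupAlgebra.
Variable K : fieldType.

Section Def.
Variables (X : Type) (op : X -> X -> X).
Hypothesis opA : associative op.
Variable R0 : lterm K X -> lterm K X -> Prop.

Definition octx (a b : option X) (x : X) : X :=
  let y := if b is Some b' then op x b' else x in
  if a is Some a' then op a' y else y.

(* R0 translated on both sides by the elements of X: its differences span the
   two-sided ideal of the semigroup algebra K[X] generated by R0. *)
Inductive ideal_rel : lterm K X -> lterm K X -> Prop :=
| IdealRel a b t u : R0 t u ->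
    ideal_rel (lsubst (octx a b) t) (lsubst (octx a b) u).

Lemma lsubst_comp (Y Z W : Type) (f : Z -> W) (g : Y -> Z) (t : lterm K Y) :
  lsubst f (lsubst g t) = lsubst (f \o g) t.
Proof. by elim: t => //= [t -> u ->|c t ->]. Qed.

Lemma eq_lsubst (Y Z : Type) (f g : Y -> Z) (t : lterm K Y) :
  f =1 g -> lsubst f t = lsubst g t.
Proof. by move=> fg; elim: t => //= [x|t -> u ->|c t ->]; rewrite ?fg. Qed.

Lemma ideal_stab_l x t u : ideal_rel t u ->
  lcong ideal_rel (lsubst (op x) t) (lsubst (op x) u).
Proof.
case=> a b {}t {}u tu; rewrite !lsubst_comp; apply: lc_rel.
have E : op x \o octx a b =1 octx (Some (if a is Some a0 then op x a0 else x)) b.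
  by move=> y; rewrite /octx /=; case: a; case: b => * //=; rewrite !opA.
by rewrite !(eq_lsubst _ E); constructor.
Qed.

Lemma ideal_stab_r x t u : ideal_rel t u ->
  lcong ideal_rel (lsubst (op^~ x) t) (lsubst (op^~ x) u).
Proof.
case=> a b {}t {}u tu; rewrite !lsubst_comp; apply: lc_rel.
have E : op^~ x \o octx a b =1 octx a (Some (if b is Some b0 then op b0 x else x)).
  by move=> y; rewrite /octx /=; case: a; case: b => * //=; rewrite !opA.
by rewrite !(eq_lsubst _ E); constructor.
Qed.

(* The semigroup algebra K[X] modulo the two-sided ideal generated by R0. *)
Definition sgalg (_ : associative op) : Type := lpres ideal_rel.
Notation SG := (sgalg opA).

HB.instance Definition _ := GRing.Lmodule.on SG.

Definition sgmul : SG -> SG -> SG := lmul ideal_stab_l ideal_stab_r.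

HB.instance Definition _ := Lmodule_isNUAlgebra.Build K SG
  (lmulA opA ideal_stab_l ideal_stab_r : associative sgmul)
  (lmulDZl ideal_stab_l ideal_stab_r)
  (fun c a b x => lmulDZr ideal_stab_l ideal_stab_r c a b x).

Definition sggen (x : X) : SG := lgen ideal_rel x.

Lemma sggenM x y : numul (sggen x) (sggen y) = sggen (op x y).
Proof. exact: lmul_gen. Qed.

Lemma sggen_rel t u : R0 t u -> leval sggen t = leval sggen u.
Proof.
move=> tu; rewrite /sggen -!lpiE; apply/lpiP; apply: lc_rel.
have idE v : lsubst (octx None None) v = v.
  by elim: v => //= [v -> w ->|c v ->].
by have := IdealRel None None tu; rewrite !idE.
Qed.

Lemma sgalg_ind (P : SG -> Prop) :
  P 0 -> (forall x, P (sggen x)) -> (forall p q, P p -> P q -> P (p + q)) ->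
  (forall c p, P p -> P (c *: p)) -> forall p, P p.
Proof. exact: lpres_ind. Qed.

Lemma sgalg_linear_eq (U : lmodType K) (f g : {linear SG -> U}) :
  (forall x, f (sggen x) = g (sggen x)) -> f =1 g.
Proof. exact: lpres_hom_eq. Qed.

Section Hom.
Variables (B : nualgType K) (h : X -> B).
Hypothesis hM : forall x y, h (op x y) = numul (h x) (h y).
Hypothesis hR : forall t u, R0 t u -> leval h t = leval h u.

Lemma sghom_rel t u : ideal_rel t u -> leval h t = leval h u.
Proof.
case=> a b {}t {}u /hR; rewrite !leval_lsubst.
have E v : leval (h \o octx a b) v =
    let y := if b is Some b' then numul (leval h v) (h b') else leval h v in
    if a is Some a' then numul (h a') y else y.
  rewrite /octx; case: a => [a|]; case: b => [b|] /=;
    elim: v => [|x|v IH w IH'|c v IH] //=;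
    rewrite ?IH ?IH' ?hM ?numul0l ?numul0r //;
    by rewrite ?numulDl ?numulDr ?numulZl ?numulZr.
by rewrite !E => ->.
Qed.

Definition sghom_lin : {linear SG -> B} := lext sghom_rel.

Lemma sghom_gen x : sghom_lin (sggen x) = h x.
Proof. exact: lextE. Qed.

Lemma sghomM x y : sghom_lin (numul x y) = numul (sghom_lin x) (sghom_lin y).
Proof.
elim/sgalg_ind: x => [|x|x x' Hx Hx'|c x Hx].
- by rewrite numul0l !linear0 numul0l.
- elim/sgalg_ind: y => [|y|y y' Hy Hy'|c y Hy].
  + by rewrite numul0r !linear0 numul0r.
  + by rewrite sggenM !sghom_gen hM.
  + by rewrite numulDr !linearD numulDr Hy Hy'.
  + by rewrite numulZr !linearZ numulZr Hy.
- by rewrite numulDl !linearD numulDl Hx Hx'.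
- by rewrite numulZl !linearZ numulZl Hx.
Qed.

Definition sghom : nuhom SG B := NUHom (linearP sghom_lin) sghomM.

Lemma sghomE x : sghom (sggen x) = h x.
Proof. exact: sghom_gen. Qed.

End Hom.
End Def.
End SemigroupAlgebra.

(* Nonempty words: the free semigroup on L. *)
Inductive word (L : Type) : Type := WLetter of L | WCons of L & word L.

Fixpoint wcat (L : Type) (v w : word L) : word L :=
  match v with
  | WLetter a => WCons a w
  | WCons a v' => WCons a (wcat v' w)
  end.

Lemma wcatA (L : Type) : associative (@wcat L).
Proof. by move=> u v w; elim: u => //= a u ->. Qed.

Fixpoint wseq (L : Type) (w : word L) : seq L :=
  match w with
  | WLetter a => [:: a]
  | WCons a w' => a :: wseq w'
  end.

Fixpoint wprod (K : fieldType) (A : nualgType K) (L : Type) (f : L -> A)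
    (w : word L) : A :=
  match w with
  | WLetter a => f a
  | WCons a w' => numul (f a) (wprod f w')
  end.

Lemma wprod_cat (K : fieldType) (A : nualgType K) (L : Type) (f : L -> A) v w :
  wprod f (wcat v w) = numul (wprod f v) (wprod f w).
Proof. by elim: v => //= a v ->; rewrite numulA. Qed.

Section TensorAlgebra.
Variables (K : fieldType) (V : lmodType K).

Inductive tensalg_rel : lterm K (word V) -> lterm K (word V) -> Prop :=
| TensLin c u v : tensalg_rel (LGen K (WLetter (c *: u + v)))
    (LAdd (LScale c (LGen K (WLetter u))) (LGen K (WLetter v))).

(* The direct sum of the tensor powers of V of positive degree: the words
   v1 ... vk of length k >= 1 modulo multilinearity, i.e. the elementary
   tensors v1 (x) ... (x) vk. *)
Definition tensalg : nualgType K := sgalg tensalg_rel (@wcatA V).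

Definition tword (w : word V) : tensalg := sggen (@wcatA V) tensalg_rel w.
Definition tgen (v : V) : tensalg := tword (WLetter v).

Lemma tgen_linear : linear tgen.
Proof.
move=> c u v.
exact: (sggen_rel (@wcatA V) (TensLin c u v)).
Qed.

Lemma tword_prod w : tword w = wprod tgen w.
Proof. by elim: w => //= a w <-; rewrite sggenM. Qed.

Section Lift.
Variables (B : nualgType K) (f : {linear V -> B}).

Lemma tensalg_lift_rel t u : tensalg_rel t u -> leval (wprod f) t = leval (wprod f) u.
Proof. by case=> c a b /=; rewrite linearP. Qed.

Definition tensalg_lift : nuhom tensalg B :=
  sghom (@wcatA V) (wprod_cat f) tensalg_lift_rel.

Lemma tensalg_liftE v : tensalg_lift (tgen v) = f v.
Proof. exact: sghomE. Qed.
End Lift.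

Lemma tensalg_hom_eq (B : nualgType K) (f g : nuhom tensalg B) :
  (forall v, f (tgen v) = g (tgen v)) -> f =1 g.
Proof.
move=> fg; apply: sgalg_linear_eq => w.
elim: w => [v|v w IH]; first exact: fg.
have -> : sggen (@wcatA V) tensalg_rel (WCons v w) = numul (tgen v) (tword w).
  by rewrite sggenM.
rewrite [LHS](nuhomM f) [RHS](nuhomM g) fg; congr numul; exact: IH.
Qed.
End TensorAlgebra.

Section FreeProduct.
Variables (K : fieldType) (I : Type) (A : I -> nualgType K).

Definition letter : Type := {i : I & A i}.
Definition ltr i (a : A i) : letter := existT (fun i => A i : Type) i a.

Inductive fprod_rel : lterm K (word letter) -> lterm K (word letter) -> Prop :=
| FprodLin i c (a b : A i) : fprod_rel (LGen K (WLetter (ltr (c *: a + b))))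
    (LAdd (LScale c (LGen K (WLetter (ltr a)))) (LGen K (WLetter (ltr b))))
| FprodMul i (a b : A i) : fprod_rel
    (LGen K (WCons (ltr a) (WLetter (ltr b))))
    (LGen K (WLetter (ltr (numul a b)))).

(* The free product (coproduct) of the algebras A i. *)
Definition fprod : nualgType K := sgalg fprod_rel (@wcatA letter).

Definition fword (w : word letter) : fprod :=
  sggen (@wcatA letter) fprod_rel w.

Definition fin_fun i (a : A i) : fprod := fword (WLetter (ltr a)).

Lemma fin_linear i : linear (@fin_fun i).
Proof.
move=> c u v; exact: (sggen_rel (@wcatA letter) (FprodLin c u v)).
Qed.

Lemma finM i (a b : A i) :
  fin_fun (numul a b) = numul (fin_fun a) (fin_fun b).
Proof.
rewrite [RHS]sggenM /=; apply/esym.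
exact: (sggen_rel (@wcatA letter) (FprodMul a b)).
Qed.

Definition fin i : nuhom (A i) fprod := NUHom (@fin_linear i) (@finM i).

Section Case.
Variables (B : nualgType K) (f : forall i, nuhom (A i) B).

Definition fcase_letter (x : letter) : B := f (projT1 x) (projT2 x).

Lemma fcase_rel t u : fprod_rel t u ->
  leval (wprod fcase_letter) t = leval (wprod fcase_letter) u.
Proof.
by case=> [i c a b|i a b] /=; rewrite /fcase_letter /= ?linearP ?nuhomM.
Qed.

Definition fcase : nuhom fprod B :=
  sghom (@wcatA letter) (wprod_cat fcase_letter) fcase_rel.

Lemma fcaseE i (a : A i) : fcase (fin i a) = f i a.
Proof. exact: sghomE. Qed.
End Case.

Lemma fprod_hom_eq (B : nualgType K) (f g : nuhom fprod B) :
  (forall i (a : A i), f (fin i a) = g (fin i a)) -> f =1 g.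
Proof.
move=> fg; apply: sgalg_linear_eq => w.
elim: w => [[i a]|[i a] w IH]; first exact: fg.
have -> : sggen (@wcatA letter) fprod_rel (WCons (ltr a) w) =
    numul (fin i a) (fword w) by rewrite sggenM.
rewrite [LHS](nuhomM f) [RHS](nuhomM g) fg; congr numul; exact: IH.
Qed.
End FreeProduct.

Definition fmap (K : fieldType) (I : Type) (A B : I -> nualgType K)
    (f : forall i, nuhom (A i) (B i)) : nuhom (fprod A) (fprod B) :=
  fcase (fun i => nucomp (fin B i) (f i)).

Section FreeProduct2.
Variable K : fieldType.

Definition fam2 (A1 A2 : nualgType K) (b : bool) : nualgType K :=
  if b then A1 else A2.

Definition fprod2 (A1 A2 : nualgType K) : nualgType K := fprod (fam2 A1 A2).

Definition in1 (A1 A2 : nualgType K) : nuhom A1 (fprod2 A1 A2) :=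
  fin (fam2 A1 A2) true.
Definition in2 (A1 A2 : nualgType K) : nuhom A2 (fprod2 A1 A2) :=
  fin (fam2 A1 A2) false.

Definition case2 (A1 A2 B : nualgType K) (f1 : nuhom A1 B) (f2 : nuhom A2 B) :
    nuhom (fprod2 A1 A2) B :=
  fcase (A := fam2 A1 A2)
    (fun b => if b return nuhom (fam2 A1 A2 b) B then f1 else f2).

Definition map2 (A1 A2 B1 B2 : nualgType K) (f1 : nuhom A1 B1)
    (f2 : nuhom A2 B2) : nuhom (fprod2 A1 A2) (fprod2 B1 B2) :=
  case2 (nucomp (in1 B1 B2) f1) (nucomp (in2 B1 B2) f2).

Lemma case2_in1 (A1 A2 B : nualgType K) (f1 : nuhom A1 B) (f2 : nuhom A2 B) a :
  case2 f1 f2 (in1 A1 A2 a) = f1 a.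
Proof. exact: (fcaseE (A := fam2 A1 A2) _ (i := true)). Qed.

Lemma case2_in2 (A1 A2 B : nualgType K) (f1 : nuhom A1 B) (f2 : nuhom A2 B) a :
  case2 f1 f2 (in2 A1 A2 a) = f2 a.
Proof. exact: (fcaseE (A := fam2 A1 A2) _ (i := false)). Qed.

Lemma fprod2_hom_eq (A1 A2 B : nualgType K) (f g : nuhom (fprod2 A1 A2) B) :
  (forall a, f (in1 A1 A2 a) = g (in1 A1 A2 a)) ->
  (forall a, f (in2 A1 A2 a) = g (in2 A1 A2 a)) -> f =1 g.
Proof. by move=> H1 H2; apply: fprod_hom_eq => -[] a; [apply: H1|apply: H2]. Qed.
End FreeProduct2.

Section Subalgebra.
Variables (K : fieldType) (A : nualgType K).

Record subalg := SubAlg {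
  sa_pred : {pred A};
  sa_submod : submod_closed sa_pred;
  sa_mul : forall x y,
    x \in sa_pred -> y \in sa_pred -> numul x y \in sa_pred
}.

Variable S : subalg.

Record subalgT_type := SubAlgT { sa_val : A; sa_valP : sa_val \in sa_pred S }.

HB.instance Definition _ := [isSub for sa_val].
HB.instance Definition _ := [Choice of subalgT_type by <:].
HB.instance Definition _ := GRing.SubChoice_isSubLmodule.Build K A
  (sa_pred S) subalgT_type (GRing.submod_closed_semi (sa_submod S)).

Definition sa_numul (x y : subalgT_type) : subalgT_type :=
  SubAlgT (sa_mul (sa_valP x) (sa_valP y)).

Lemma sa_numulA : associative sa_numul.
Proof. by move=> x y z; apply: val_inj; rewrite /= numulA. Qed.
Lemma sa_numulDZl c a b x :
  sa_numul (c *: a + b) x = c *: sa_numul a x + sa_numul b x.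
Proof.
have valE (u v : subalgT_type) : val (c *: u + v) = c *: val u + val v.
  exact: linearP.
apply: val_inj; rewrite [RHS]valE.
exact: etrans (congr1 (fun y => numul y (val x)) (valE a b)) (numulDZl _ _ _ _).
Qed.
Lemma sa_numulDZr c a b x :
  sa_numul x (c *: a + b) = c *: sa_numul x a + sa_numul x b.
Proof.
have valE (u v : subalgT_type) : val (c *: u + v) = c *: val u + val v.
  exact: linearP.
apply: val_inj; rewrite [RHS]valE.
exact: etrans (congr1 (fun y => numul (val x) y) (valE a b)) (numulDZr _ _ _ _).
Qed.

HB.instance Definition _ := Lmodule_isNUAlgebra.Build K subalgT_type
  sa_numulA sa_numulDZl sa_numulDZr.

Definition subalgT : nualgType K := subalgT_type.

Lemma sa_val_linear : linear (sa_val : subalgT -> A).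
Proof. exact: (linearP (val : subalgT_type -> A)). Qed.
Definition sa_incl : nuhom subalgT A :=
  NUHom sa_val_linear (fun _ _ => erefl).

End Subalgebra.

Section Image.
Variables (K : fieldType) (A B : nualgType K) (f : nuhom A B).

Definition im_pred : {pred B} := [pred y | `[< exists x, y = f x >]].

Lemma im_submod : submod_closed im_pred.
Proof.
split; first by apply/asboolP; exists 0; rewrite linear0.
move=> c _ _ /asboolP[x ->] /asboolP[y ->]; apply/asboolP.
by exists (c *: x + y); rewrite linearP.
Qed.

Lemma im_mul x y : x \in im_pred -> y \in im_pred -> numul x y \in im_pred.
Proof.
move=> /asboolP[{}x ->] /asboolP[{}y ->]; apply/asboolP.
by exists (numul x y); rewrite nuhomM.
Qed.

Definition im_subalg : subalg B := SubAlg im_submod im_mul.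

Lemma mem_im x : f x \in sa_pred im_subalg.
Proof. by apply/asboolP; exists x. Qed.

Definition corestr_fun (x : A) : subalgT im_subalg := SubAlgT (mem_im x).

Lemma corestr_linear : linear corestr_fun.
Proof.
by move=> c x y; apply: val_inj; rewrite linearP /= linearP.
Qed.

Lemma corestrM x y :
  corestr_fun (numul x y) = numul (corestr_fun x) (corestr_fun y).
Proof. by apply: val_inj; rewrite /= nuhomM. Qed.

Definition corestr : nuhom A (subalgT im_subalg) :=
  NUHom corestr_linear corestrM.

Lemma corestrE x : sa_incl im_subalg (corestr x) = f x.
Proof. by []. Qed.

Lemma corestr_surj (y : subalgT im_subalg) : exists x, y = corestr x.
Proof.
by case: y => y yP; have /asboolP[x E] := yP; exists x; apply: val_inj.
Qed.

End Image.

Lemma nuhom_inv (K : fieldType) (A B : nualgType K) (f : nuhom A B) :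
  bijective f -> exists g : nuhom B A, cancel f g /\ cancel g f.
Proof.
case=> g fK gK.
have g_lin : linear g.
  by move=> c x y; apply: (can_inj fK); rewrite (nuhom_linear f) !gK.
have gM x y : g (numul x y) = numul (g x) (g y).
  by apply: (can_inj fK); rewrite nuhomM !gK.
by exists (NUHom g_lin gM).
Qed.

Section FacedAlgebra.
Variables (K : fieldType) (m : nat).

(* Objects of AlgP_{d,m} without the functional. fcase (sa_incl (fa_face l))_l
   is the canonical map from the free product of the faces. *)
Record facedAlg := FacedAlg {
  fa_alg :> nualgType K;
  fa_face : 'I_m -> subalg fa_alg;
  fa_free : bijective (fcase (fun l => sa_incl (fa_face l)))
}.

Definition face_hom (B A : facedAlg) (j : nuhom B A) : Prop :=
  forall l x, x \in sa_pred (fa_face B l) -> j x \in sa_pred (fa_face A l).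

Section Prod.
Variables A1 A2 : facedAlg.

(* The l-th face of A1 |_| A2 is the image of the free product of the l-th
   faces of A1 and A2. *)
Definition prod_face_map (l : 'I_m) :=
  map2 (sa_incl (fa_face A1 l)) (sa_incl (fa_face A2 l)).

Definition prod_face (l : 'I_m) : subalg (fprod2 A1 A2) :=
  im_subalg (prod_face_map l).

Lemma prod_free : bijective (fcase (fun l => sa_incl (prod_face l))).
Proof.
have [g1 [f1K g1K]] := nuhom_inv (fa_free A1).
have [g2 [f2K g2K]] := nuhom_inv (fa_free A2).
set can := fcase _.
pose SF l := subalgT (prod_face l).
pose cr l : nuhom _ (SF l) := corestr (prod_face_map l).
pose k1 := fcase (fun l => nucomp (fin SF l) (nucomp (cr l)
   (in1 (subalgT (fa_face A1 l)) (subalgT (fa_face A2 l))))).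
pose k2 := fcase (fun l => nucomp (fin SF l) (nucomp (cr l)
   (in2 (subalgT (fa_face A1 l)) (subalgT (fa_face A2 l))))).
pose h := case2 (nucomp k1 g1) (nucomp k2 g2).
have can_cr l z : can (fin SF l (cr l z)) = prod_face_map l z.
  by rewrite /can (fcaseE (A := SF)).
exists h.
- apply: (fprod_hom_eq (f := nucomp h can) (g := nuid _)) => l y.
  have [z ->] := corestr_surj y.
  apply: (fprod2_hom_eq (f := nucomp (nucomp h can) (nucomp (fin SF l) (cr l)))
     (g := nucomp (fin SF l) (cr l))) => x.
  + rewrite !nucompE can_cr /prod_face_map /map2 case2_in1 /h nucompE case2_in1.
    have -> : sa_incl (fa_face A1 l) x =
       fcase (fun l => sa_incl (fa_face A1 l)) (fin _ l x) by rewrite fcaseE.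
    by rewrite nucompE f1K /k1 fcaseE.
  + rewrite !nucompE can_cr /prod_face_map /map2 case2_in2 /h nucompE case2_in2.
    have -> : sa_incl (fa_face A2 l) x =
       fcase (fun l => sa_incl (fa_face A2 l)) (fin _ l x) by rewrite fcaseE.
    by rewrite nucompE f2K /k2 fcaseE.
- apply: (fprod2_hom_eq (f := nucomp can h) (g := nuid _)) => a.
  + rewrite nucompE /h case2_in1 nucompE -[in RHS](g1K a).
    move: (g1 a) => b.
    apply: (fprod_hom_eq (f := nucomp can k1)
      (g := nucomp (in1 A1 A2) (fcase (fun l => sa_incl (fa_face A1 l))))).
    move=> l x; by rewrite [in LHS]nucompE /k1 fcaseE !nucompE can_cr fcaseE nucompE fcaseE.
  + rewrite nucompE /h case2_in2 nucompE -[in RHS](g2K a).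
    move: (g2 a) => b.
    apply: (fprod_hom_eq (f := nucomp can k2)
      (g := nucomp (in2 A1 A2) (fcase (fun l => sa_incl (fa_face A2 l))))).
    move=> l x; by rewrite [in LHS]nucompE /k2 fcaseE !nucompE can_cr fcaseE nucompE fcaseE.
Qed.

Definition faced_prod : facedAlg := FacedAlg prod_free.

End Prod.

Section Copies.
Variable B : 'I_m -> nualgType K.

Definition copy_face (l : 'I_m) : subalg (fprod B) := im_subalg (fin B l).

Lemma copy_free : bijective (fcase (fun l => sa_incl (copy_face l))).
Proof.
set can := fcase _.
pose SF l := subalgT (copy_face l).
pose cr l : nuhom (B l) (SF l) := corestr (fin B l).
pose h := fcase (fun l => nucomp (fin SF l) (cr l)).
have can_cr l z : can (fin SF l (cr l z)) = fin B l z.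
  by rewrite /can (fcaseE (A := SF)).
exists h.
- apply: (fprod_hom_eq (f := nucomp h can) (g := nuid _)) => l y.
  have [z ->] := corestr_surj y.
  by rewrite nucompE can_cr /h fcaseE.
- apply: (fprod_hom_eq (f := nucomp can h) (g := nuid _)) => l z.
  by rewrite nucompE /h fcaseE nucompE can_cr.
Qed.

Definition faced_copies : facedAlg := FacedAlg copy_free.

End Copies.
End FacedAlgebra.

Section Span.
Variables (K : fieldType) (U : lmodType K).

Definition subspace (P : set U) : Prop :=
  P 0 /\ forall c u v, P u -> P v -> P (c *: u + v).

Inductive lspan (P : set U) : set U :=
| lspan0 : lspan P 0
| lspanDZ c u v : P u -> lspan P v -> lspan P (c *: u + v).

Lemma lspan_sub (P : set U) u : P u -> lspan P u.
Proof.
by move=> Pu; rewrite -[u]scale1r -[_ *: _]addr0; apply: lspanDZ => //; left.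
Qed.

Lemma lspan_subspace (P : set U) : subspace (lspan P).
Proof.
split=> [|c u v Pu]; first by left.
elim: Pu v => [v|a u1 u2 Pu1 _ IH v Pv]; first by rewrite scaler0 add0r.
by rewrite scalerDr scalerA -addrA; apply: lspanDZ => //; exact: IH.
Qed.

Lemma lspan_mono (P Q : set U) : (P `<=` Q -> lspan P `<=` lspan Q)%classic.
Proof.
move=> PQ u; elim=> [|c x y Px _ Qy]; first by left.
by apply: lspanDZ => //; exact: PQ.
Qed.

Lemma functional_at (v : U) : v != 0 -> exists f : {linear U -> K^o}, f v = 1.
Proof.
move=> v0.
have chain (F : set (set U)) : total_on F subset ->
    forall x, lspan (\bigcup_(X in F) X)%classic x ->
    x = 0 \/ exists2 X, F X & lspan X x.
  move=> Ft x; elim=> [|c u w [X FX Xu] _ [->|[Y FY Yw]]]; first by left.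
  - by right; exists X => //; apply: lspanDZ => //; left.
  - right; have [XY|YX] := Ft _ _ FX FY.
      by exists Y => //; apply: lspanDZ => //; exact: XY.
    by exists X => //; apply: lspanDZ => //; exact: lspan_mono YX _ Yw.
have [A [NAv Amax]] : exists A : set U, ~ lspan A v /\
    forall B, (A `<` B)%classic -> ~ ~ lspan B v.
  apply: (Zorn_bigcup (P := [set X | ~ lspan X v])) => F FP Ft.
  move=> /(chain _ Ft)[v00|[X FX]]; first by rewrite v00 eqxx in v0.
  exact: FP.
have [A0 AD] := lspan_subspace A.
have AZ c x : lspan A x -> lspan A (c *: x).
  by move=> Ax; rewrite -[_ *: _]addr0; exact: AD.
have dec x : exists c, lspan A (x - c *: v).
  have [Ax|NAx] := pselect (lspan A x); first by exists 0; rewrite scale0r subr0.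
  pose B := (A `|` [set x])%classic.
  have ABx : (A `<` B)%classic.
    split; first by move=> y Ay; left.
    by move=> BA; apply: NAx; apply/lspan_sub/BA; right.
  have Bdec y : lspan B y -> exists a, lspan A (y - a *: x).
    elim=> [|c u w Bu _ [a Aw]]; first by exists 0; rewrite scale0r subr0.
    case: Bu => [Au|->].
      by exists a; rewrite -addrA; apply: AD => //; exact: lspan_sub.
    exists (c + a); rewrite scalerDl opprD addrACA subrr add0r //.
  have [a Av] := Bdec _ (contrapT (Amax _ ABx)).
  have a0 : a != 0.
    by apply/eqP => a0; apply: NAv; move: Av; rewrite a0 scale0r subr0.
  exists a^-1; have := AZ (- a^-1) _ Av.
  by rewrite scalerBr scalerA mulNr mulVf // scaleN1r opprK scaleNr addrC.
have uniq_c c : lspan A (c *: v) -> c = 0.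
  move=> Acv; have [//|c0] := eqVneq c 0; case: NAv.
  by have := AZ c^-1 _ Acv; rewrite scalerA mulVf // scale1r.
pose f x : K^o := sval (cid (dec x)).
have fP x : lspan A (x - f x *: v) by exact: svalP (cid (dec x)).
have fE x c : lspan A (x - c *: v) -> f x = c.
  move=> Ac; apply/eqP; rewrite -subr_eq0; apply/eqP; apply: uniq_c.
  have := AD (-1) _ _ (fP x) Ac.
  by rewrite scaleN1r opprB addrA subrK scalerBl.
have f_lin : linear f.
  move=> c x y; apply: fE.
  have -> : c *: x + y - (c *: f x + f y) *: v =
      c *: (x - f x *: v) + (y - f y *: v).
    by rewrite scalerDl opprD addrACA scalerBr scalerA.
  exact: AD.
exists (HB.pack f (GRing.isLinear.Build K U K^o _ f f_lin) : {linear U -> K^o}).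
by apply: fE; rewrite scale1r subrr.
Qed.

End Span.

Section TensorProduct.
Variable K : fieldType.

Section Def.
Variables U V : lmodType K.

Inductive bilin_rel : lterm K (U * V) -> lterm K (U * V) -> Prop :=
| BilinL c u u' v : bilin_rel (LGen K (c *: u + u', v))
    (LAdd (LScale c (LGen K (u, v))) (LGen K (u', v)))
| BilinR c u v v' : bilin_rel (LGen K (u, c *: v + v'))
    (LAdd (LScale c (LGen K (u, v))) (LGen K (u, v'))).

Definition tens : Type := lpres bilin_rel.
HB.instance Definition _ := GRing.Lmodule.on tens.

Definition tpure (u : U) (v : V) : tens := lgen bilin_rel (u, v).

Lemma tpure_linl v : linear (tpure^~ v).
Proof.
move=> c u u'; have := lc_rel (BilinL c u u' v).
by move=> /(lpiP bilin_rel); rewrite !lpiE.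
Qed.

Lemma tpure_linr u : linear (tpure u).
Proof.
move=> c v v'; have := lc_rel (BilinR c u v v').
by move=> /(lpiP bilin_rel); rewrite !lpiE.
Qed.

Lemma tens_ind (P : tens -> Prop) :
  P 0 -> (forall u v, P (tpure u v)) -> (forall p q, P p -> P q -> P (p + q)) ->
  (forall c p, P p -> P (c *: p)) -> forall p, P p.
Proof. by move=> P0 Pg; apply: lpres_ind => // -[u v]; exact: Pg. Qed.

Section Lift.
Variables (W : lmodType K) (f : U -> V -> W).
Hypotheses (f_linl : forall v, linear (f^~ v)) (f_linr : forall u, linear (f u)).

Lemma tlift_fun_rel t u : bilin_rel t u ->
  leval (fun p => f p.1 p.2) t = leval (fun p => f p.1 p.2) u.
Proof. by case=> [c a b v|c u' v v'] /=; [exact: f_linl|exact: f_linr]. Qed.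

Definition tlift : {linear tens -> W} := lext tlift_fun_rel.

Lemma tliftE u v : tlift (tpure u v) = f u v.
Proof. exact: lextE. Qed.
End Lift.

Lemma tens_linear_eq (W : lmodType K) (f g : {linear tens -> W}) :
  (forall u v, f (tpure u v) = g (tpure u v)) -> f =1 g.
Proof. by move=> fg; apply: lpres_hom_eq => -[u v]; exact: fg. Qed.

End Def.

Section Map.
Variables (U U' V V' : lmodType K).
Variables (f : {linear U -> U'}) (g : {linear V -> V'}).

Lemma tmap_linl v : linear (fun u => tpure (f u) (g v)).
Proof. by move=> c a b /=; rewrite linearP (tpure_linl (g v)). Qed.
Lemma tmap_linr u : linear (fun v => tpure (f u) (g v)).
Proof. by move=> c a b /=; rewrite linearP (tpure_linr (f u)). Qed.

Definition tmap : {linear tens U V -> tens U' V'} := tlift tmap_linl tmap_linr.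

Lemma tmapE u v : tmap (tpure u v) = tpure (f u) (g v).
Proof. exact: tliftE. Qed.
End Map.

Section Assoc.
Variables U V W : lmodType K.

Definition tpure_r (w : W) (v : V) : tens V W := tpure v w.
HB.instance Definition _ (w : W) :=
  GRing.isLinear.Build K V (tens V W) _ (tpure_r w) (tpure_linl w).

Definition tassoc_at (w : W) : {linear tens U V -> tens U (tens V W)} :=
  tmap idfun (tpure_r w).

Lemma tassoc_linl w : linear (tassoc_at w).
Proof. exact: linearP. Qed.
Lemma tassoc_linr p : linear (tassoc_at^~ p).
Proof.
move=> c w w'; elim/tens_ind: p => [|u v|p q Hp Hq|a p Hp].
- by rewrite !linear0 ?scaler0 ?addr0.
- by rewrite !tmapE /= /tpure_r (tpure_linr v) (tpure_linr u).
- by rewrite !(linearD (tassoc_at _)) Hp Hq scalerDr addrACA.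
- by rewrite !(linearZ_LR (tassoc_at _)) Hp scalerDr !scalerA mulrC.
Qed.

(* The isomorphism (u (x) v) (x) w |-> u (x) (v (x) w). *)
Definition tassoc : {linear tens (tens U V) W -> tens U (tens V W)} :=
  tlift (f := fun p w => tassoc_at w p) tassoc_linl tassoc_linr.

Lemma tassocE u v w : tassoc (tpure (tpure u v) w) = tpure u (tpure v w).
Proof. by rewrite tliftE tmapE. Qed.
End Assoc.

Lemma tpure_neq0 (U V : lmodType K) (u : U) (v : V) :
  u != 0 -> v != 0 -> tpure u v != 0.
Proof.
move=> /functional_at[f fu] /functional_at[g gv]; apply/eqP => uv0.
have Hl y : linear (fun x => f x * g y : K^o).
  by move=> c a b /=; rewrite linearP mulrDl -scalerAl.
have Hr x : linear (fun y => f x * g y : K^o).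
  by move=> c a b /=; rewrite linearP mulrDr -scalerAr.
have := tliftE Hl Hr u v; rewrite uv0 linear0 fu gv mulr1 => /esym/eqP.
by rewrite oner_eq0.
Qed.

Section Algebra.
Variables A B : algType K.
Notation T := (tens A B).

Definition pairmul (x y : A * B) : A * B := (x.1 * y.1, x.2 * y.2).

Lemma pairmulA : associative pairmul.
Proof. by move=> x y z; rewrite /pairmul /= !mulrA. Qed.

Lemma bilin_stab_l x t u : bilin_rel t u ->
  lcong (@bilin_rel A B) (lsubst (pairmul x) t) (lsubst (pairmul x) u).
Proof.
case=> [c a b v|c a v v'] /=; rewrite /pairmul /=; apply: lc_rel;
  by rewrite mulrDr -scalerAr; constructor.
Qed.

Lemma bilin_stab_r x t u : bilin_rel t u ->
  lcong (@bilin_rel A B) (lsubst (pairmul^~ x) t) (lsubst (pairmul^~ x) u).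
Proof.
case=> [c a b v|c a v v'] /=; rewrite /pairmul /=; apply: lc_rel;
  by rewrite mulrDl -scalerAl; constructor.
Qed.

Definition tensmul (p q : T) : T := lmul bilin_stab_l bilin_stab_r p q.
Definition tensone : T := tpure 1 1.

Lemma tensmulE a b a' b' :
  tensmul (tpure a b) (tpure a' b') = tpure (a * a') (b * b').
Proof. exact: lmul_gen. Qed.

Lemma tensmulDZl c p p' q :
  tensmul (c *: p + p') q = c *: tensmul p q + tensmul p' q.
Proof. exact: lmulDZl. Qed.
Lemma tensmulDZr c p p' q :
  tensmul q (c *: p + p') = c *: tensmul q p + tensmul q p'.
Proof. exact: lmulDZr. Qed.

Lemma tensmulA : associative tensmul.
Proof. exact: (lmulA pairmulA bilin_stab_l bilin_stab_r). Qed.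
Lemma tensmulDl : left_distributive tensmul +%R.
Proof. by move=> p q r; rewrite -[p in LHS]scale1r tensmulDZl scale1r. Qed.
Lemma tensmulDr : right_distributive tensmul +%R.
Proof. by move=> r p q; rewrite -[p in LHS]scale1r tensmulDZr scale1r. Qed.
Lemma tensmul0l q : tensmul 0 q = 0.
Proof. by apply: (addIr (tensmul 0 q)); rewrite -tensmulDl !add0r. Qed.
Lemma tensmul0r q : tensmul q 0 = 0.
Proof. by apply: (addIr (tensmul q 0)); rewrite -tensmulDr !add0r. Qed.
Lemma tensmulZl c p q : c *: tensmul p q = tensmul (c *: p) q.
Proof. by rewrite -[c *: p]addr0 tensmulDZl tensmul0l addr0. Qed.
Lemma tensmulZr c p q : c *: tensmul p q = tensmul p (c *: q).
Proof. by rewrite -[c *: q]addr0 tensmulDZr tensmul0r addr0. Qed.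

Lemma tensmul1l : left_id tensone tensmul.
Proof.
elim/tens_ind => [|u v|p q Hp Hq|c p Hp].
- by rewrite tensmul0r.
- by rewrite tensmulE !mul1r.
- by rewrite tensmulDr Hp Hq.
- by rewrite -tensmulZr Hp.
Qed.
Lemma tensmul1r : right_id tensone tensmul.
Proof.
elim/tens_ind => [|u v|p q Hp Hq|c p Hp].
- by rewrite tensmul0l.
- by rewrite tensmulE !mulr1.
- by rewrite tensmulDl Hp Hq.
- by rewrite -tensmulZl Hp.
Qed.
Lemma tensone_neq0 : tensone != 0.
Proof. by apply: tpure_neq0; exact: oner_neq0. Qed.

HB.instance Definition _ := GRing.Zmodule_isNzRing.Build T
  tensmulA tensmul1l tensmul1r tensmulDl tensmulDr tensone_neq0.
HB.instance Definition _ := GRing.Lmodule_isLalgebra.Build K T tensmulZl.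
HB.instance Definition _ := GRing.Lalgebra_isAlgebra.Build K T tensmulZr.

End Algebra.

Section ComAlgebra.
Variables A B : comAlgType K.

Lemma tensmulC : commutative (@tensmul A B).
Proof.
move=> p q; elim/tens_ind: p => [|u v|p p' Hp Hp'|c p Hp].
- by rewrite tensmul0l tensmul0r.
- elim/tens_ind: q => [|u' v'|q q' Hq Hq'|c q Hq].
  + by rewrite tensmul0l tensmul0r.
  + by rewrite !tensmulE mulrC [v * _]mulrC.
  + by rewrite tensmulDl tensmulDr Hq Hq'.
  + by rewrite -tensmulZl -tensmulZr Hq.
- by rewrite tensmulDl tensmulDr Hp Hp'.
- by rewrite -tensmulZl -tensmulZr Hp.
Qed.

HB.instance Definition _ :=
  GRing.PzRing_hasCommutativeMul.Build (tens A B) tensmulC.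
End ComAlgebra.

Section Multiply.
Variable A : algType K.

Lemma tmul_linl (y : A) : linear (fun x : A => x * y).
Proof. by move=> c a b; rewrite mulrDl -scalerAl. Qed.
Lemma tmul_linr (x : A) : linear (fun y : A => x * y).
Proof. by move=> c a b; rewrite mulrDr -scalerAr. Qed.

Definition tmul : {linear tens A A -> A} := tlift tmul_linl tmul_linr.

Lemma tmulE a b : tmul (tpure a b) = a * b.
Proof. exact: tliftE. Qed.
End Multiply.
End TensorProduct.

Section SymmetricAlgebra.
Variable K : fieldType.

(* B regarded as a not necessarily unital algebra. *)
Definition nuforget (B : algType K) : Type := B.
HB.instance Definition _ (B : algType K) := GRing.Lmodule.on (nuforget B).
Lemma nuforget_DZl (B : algType K) (c : K) (a b x : nuforget B) :
  ((c *: a + b : B) * x : B) = c *: (a * x : B) + (b * x : B).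
Proof. by rewrite mulrDl -scalerAl. Qed.
Lemma nuforget_DZr (B : algType K) (c : K) (a b x : nuforget B) :
  (x * (c *: a + b : B) : B) = c *: (x * a : B) + (x * b : B).
Proof. by rewrite mulrDr -scalerAr. Qed.
HB.instance Definition _ (B : algType K) :=
  Lmodule_isNUAlgebra.Build K (nuforget B) (@mulrA B)
    (@nuforget_DZl B) (@nuforget_DZr B).

Variable W : lmodType K.

Inductive sym_rel : lterm K (seq W) -> lterm K (seq W) -> Prop :=
| SymLin c u v : sym_rel (LGen K [:: c *: u + v])
    (LAdd (LScale c (LGen K [:: u])) (LGen K [:: v]))
| SymComm u v : sym_rel (LGen K [:: u; v]) (LGen K [:: v; u]).

(* The unital tensor algebra (words in W modulo multilinearity; the empty word
   is the unit) modulo the ideal generated by uv - vu. *)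
Definition Sym : Type := sgalg sym_rel (@catA W).
HB.instance Definition _ := NUAlgebra.on Sym.

Definition sword (s : seq W) : Sym := sggen (@catA W) sym_rel s.
Definition sgen (w : W) : Sym := sword [:: w].
Definition symone : Sym := sword [::].

Lemma swordM s t : numul (sword s) (sword t) = sword (s ++ t).
Proof. exact: sggenM. Qed.

Lemma sgen_linear : linear sgen.
Proof. move=> c u v; exact: (sggen_rel (@catA W) (SymLin c u v)). Qed.

Lemma sgenC u v : numul (sgen u) (sgen v) = numul (sgen v) (sgen u).
Proof. by rewrite !swordM; exact: (sggen_rel (@catA W) (SymComm u v)). Qed.

Lemma Sym_ind (P : Sym -> Prop) :
  P 0 -> (forall x, P (sword x)) -> (forall p q, P p -> P q -> P (p + q)) ->
  (forall c p, P p -> P (c *: p)) -> forall p, P p.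
Proof. exact: sgalg_ind. Qed.

Lemma symmul1l : left_id symone (@numul K Sym).
Proof.
elim/Sym_ind => [|s|p q Hp Hq|c p Hp].
- by rewrite numul0r.
- by rewrite swordM.
- by rewrite numulDr Hp Hq.
- by rewrite numulZr Hp.
Qed.

Lemma swordC s t : numul (sword s) (sword t) = numul (sword t) (sword s).
Proof.
have sw w r : sword (w :: r) = numul (sgen w) (sword r) by rewrite swordM.
have C1 w : numul (sgen w) (sword t) = numul (sword t) (sgen w).
  elim: t => [|v r IH]; first by rewrite !swordM.
  by rewrite sw numulA sgenC -numulA IH numulA.
elim: s => [|w s IH]; first by rewrite !swordM cats0.
by rewrite sw -numulA IH numulA C1 -numulA.
Qed.

Lemma symmulC : commutative (@numul K Sym).
Proof.
move=> p q; elim/Sym_ind: p => [|s|p p' Hp Hp'|c p Hp].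
- by rewrite numul0l numul0r.
- elim/Sym_ind: q => [|t|q q' Hq Hq'|c q Hq].
  + by rewrite numul0l numul0r.
  + exact: swordC.
  + by rewrite numulDl numulDr Hq Hq'.
  + by rewrite numulZl numulZr Hq.
- by rewrite numulDl numulDr Hp Hp'.
- by rewrite numulZl numulZr Hp.
Qed.

Section Lift.
Variables (B : comAlgType K) (f : {linear W -> B}).

Definition sprod (s : seq W) : nuforget B := \prod_(w <- s) f w.

Lemma sprodM s t : sprod (s ++ t) = numul (sprod s) (sprod t).
Proof. by rewrite /sprod big_cat. Qed.

Lemma sprod_rel t u : sym_rel t u -> leval sprod t = leval sprod u.
Proof.
rewrite /sprod; case=> [c a b|a b] /=; rewrite ?big_seq1 ?big_cons ?big_nil.
  by rewrite linearP.
by rewrite !mulr1 mulrC.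
Qed.

Definition sym_nuhom : nuhom Sym (nuforget B) :=
  sghom (@catA W) sprodM sprod_rel.

Definition sym_lift_fun (p : Sym) : B := sym_nuhom p.

Lemma sym_lift_word s : sym_lift_fun (sword s) = \prod_(w <- s) f w.
Proof. exact: (sghomE (@catA W) sprodM sprod_rel s). Qed.

Lemma sym_lift_linear : linear sym_lift_fun.
Proof. exact: (nuhom_linear sym_nuhom). Qed.

Lemma sym_lift_numul p q :
  sym_lift_fun (numul p q) = sym_lift_fun p * sym_lift_fun q.
Proof. exact: (nuhomM sym_nuhom). Qed.
End Lift.

Lemma symone_neq0 : symone != 0.
Proof.
apply/eqP => /(congr1 (sym_lift_fun (\0 : {linear W -> K^o}))).
rewrite sym_lift_word big_nil [RHS](linear0 (sym_nuhom _)).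
by move/eqP; rewrite oner_eq0.
Qed.

HB.instance Definition _ := GRing.Zmodule_isComNzRing.Build Sym
  (@numulA K Sym) symmulC symmul1l
  (fun x y z => @numulDl K Sym x y z) symone_neq0.
HB.instance Definition _ := GRing.Lmodule_isLalgebra.Build K Sym
  (fun c p q => esym (@numulZl K Sym c p q)).
HB.instance Definition _ := GRing.Lalgebra_isComAlgebra.Build K Sym.

Lemma sword_prod s : sword s = \prod_(w <- s) sgen w.
Proof.
elim: s => [|w s IH]; first by rewrite big_nil.
by rewrite big_cons -IH [RHS]swordM.
Qed.

Section LRLift.
Variables (B : comAlgType K) (f : {linear W -> B}).

Lemma sym_lift_monoid : GRing.monoid_morphism (sym_lift_fun f).
Proof.
split; first by rewrite [LHS]sym_lift_word big_nil.
exact: sym_lift_numul.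
Qed.

Definition sym_lift : {lrmorphism Sym -> B} :=
  HB.pack (sym_lift_fun f)
    (GRing.isLinear.Build K Sym B _ (sym_lift_fun f) (sym_lift_linear f))
    (GRing.isMonoidMorphism.Build Sym B (sym_lift_fun f) sym_lift_monoid).

Lemma sym_liftE w : sym_lift (sgen w) = f w.
Proof. by rewrite [LHS]sym_lift_word big_seq1. Qed.
End LRLift.
End SymmetricAlgebra.

Section Powers.
Variables (K : fieldType) (d : nat).

Definition powmap (A B : lmodType K) (f : {linear A -> B})
    (x : {ffun 'I_d -> A}) : {ffun 'I_d -> B} := [ffun k => f (x k)].

Lemma powmap_linear (A B : lmodType K) (f : {linear A -> B}) :
  linear (powmap f).
Proof. by move=> c x y; apply/ffunP => k; rewrite !ffunE linearP. Qed.

HB.instance Definition _ (A B : lmodType K) (f : {linear A -> B}) :=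
  GRing.isLinear.Build K {ffun 'I_d -> A} {ffun 'I_d -> B} _ (powmap f)
    (powmap_linear f).

(* An element of A^{*d}: a d-tuple of linear functionals on A. *)
Definition ddual (A : lmodType K) : Type := 'I_d -> {linear A -> K^o}.

(* The same element, as a linear functional on A^d. *)
Definition dfun (A : lmodType K) (phi : ddual A) (x : {ffun 'I_d -> A}) : K^o :=
  \sum_(k < d) phi k (x k).

Lemma dfun_linear (A : lmodType K) (phi : ddual A) : linear (dfun phi).
Proof.
move=> c x y; rewrite /dfun scaler_sumr -big_split; apply: eq_bigr => k _ /=.
by rewrite !ffunE linearP.
Qed.

HB.instance Definition _ (A : lmodType K) (phi : ddual A) :=
  GRing.isLinear.Build K {ffun 'I_d -> A} K^o _ (dfun phi) (dfun_linear phi).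

Definition dpull (A B : nualgType K) (phi : ddual A) (j : nuhom B A) :
  ddual B := fun k => phi k \o j.

End Powers.

Section UniversalProduct.
Variables (K : fieldType) (d m : nat).

(* phi1 (.) phi2 for objects (A1, faces, phi1), (A2, faces, phi2); faced_prod
   proves that the faces of A1 |_| A2 again generate freely. *)
Definition fprod_op : Type := forall A1 A2 : facedAlg K m,
  ddual d A1 -> ddual d A2 -> ddual d (faced_prod A1 A2).

Definition assoc_map (A1 A2 A3 : nualgType K) :
    nuhom (fprod2 (fprod2 A1 A2) A3) (fprod2 A1 (fprod2 A2 A3)) :=
  case2 (case2 (in1 A1 (fprod2 A2 A3))
               (nucomp (in2 A1 (fprod2 A2 A3)) (in1 A2 A3)))
        (nucomp (in2 A1 (fprod2 A2 A3)) (in2 A2 A3)).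

Definition universal (odot : fprod_op) : Prop :=
  forall (A1 A2 B1 B2 : facedAlg K m) (j1 : nuhom B1 A1) (j2 : nuhom B2 A2),
    face_hom j1 -> face_hom j2 ->
  forall (phi1 : ddual d A1) (phi2 : ddual d A2) k (x : fprod2 B1 B2),
    odot A1 A2 phi1 phi2 k (map2 j1 j2 x) =
    odot B1 B2 (dpull phi1 j1) (dpull phi2 j2) k x.

Definition unital (odot : fprod_op) : Prop :=
  forall (A1 A2 : facedAlg K m) (phi1 : ddual d A1) (phi2 : ddual d A2) k,
    (forall a, odot A1 A2 phi1 phi2 k (in1 A1 A2 a) = phi1 k a) /\
    (forall a, odot A1 A2 phi1 phi2 k (in2 A1 A2 a) = phi2 k a).

Definition fassociative (odot : fprod_op) : Prop :=
  forall (A1 A2 A3 : facedAlg K m) (phi1 : ddual d A1) (phi2 : ddual d A2)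
    (phi3 : ddual d A3) k (x : fprod2 (fprod2 A1 A2) A3),
    odot (faced_prod A1 A2) A3 (odot A1 A2 phi1 phi2) phi3 k x =
    odot A1 (faced_prod A2 A3) phi1 (odot A2 A3 phi2 phi3) k
      (assoc_map A1 A2 A3 x).

(* Consecutive factors come from different algebras among A1, A2. *)
Definition alternating (A : bool -> nualgType K) (w : word (letter A)) : bool :=
  sorted (fun x y : letter A => projT1 x != projT1 y) (wseq w).

Definition nondegenerate (odot : fprod_op) : Prop :=
  exists (A1 A2 : facedAlg K m) (phi1 : ddual d A1) (phi2 : ddual d A2)
    (k : 'I_d) (w : word (letter (fam2 A1 A2))),
    [/\ alternating w, (1 < size (wseq w))%N &
        odot A1 A2 phi1 phi2 k (fword w) != 0].

Record is_uau (odot : fprod_op) : Prop := IsUau {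
  uau_universal : universal odot;
  uau_nondegenerate : nondegenerate odot;
  uau_unital : unital odot;
  uau_associative : fassociative odot
}.

(* phi1 (.) phi2 = (S(phi1) (x) S(phi2)) o sigma, with K (x) K identified with
   K by the multiplication. This determines sigma, as the S(phi1) (x) S(phi2)
   separate points when K is infinite. *)
Definition is_sigma (odot : fprod_op) (A1 A2 : facedAlg K m)
    (sigma : {linear {ffun 'I_d -> fprod2 A1 A2} ->
               tens (Sym {ffun 'I_d -> A1}) (Sym {ffun 'I_d -> A2})}) : Prop :=
  forall (phi1 : ddual d A1) (phi2 : ddual d A2)
    (x : {ffun 'I_d -> fprod2 A1 A2}),
    dfun (odot A1 A2 phi1 phi2) x =
    @tmul K K^o (tmap (sym_lift (dfun phi1)) (sym_lift (dfun phi2)) (sigma x)).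

End UniversalProduct.

Section HopfAlgebra.
Variables (K : fieldType) (B : algType K).
Variables (comul : {lrmorphism B -> tens B B}) (counit : {lrmorphism B -> K^o}).

(* That comul and counit are unital algebra homomorphisms is in their types;
   K (x) B and B (x) K are identified with B by b |-> 1 (x) b, b (x) 1. *)
Record is_bialgebra : Prop := IsBialgebra {
  bialg_coassoc : forall b,
    @tassoc K B B B (tmap comul idfun (comul b)) = tmap idfun comul (comul b);
  bialg_counitl : forall b, tmap counit idfun (comul b) = tpure (1 : K^o) b;
  bialg_counitr : forall b, tmap idfun counit (comul b) = tpure b (1 : K^o)
}.

Definition is_antipode (S : {linear B -> B}) : Prop := forall b,
  @tmul K B (tmap S idfun (comul b)) = (counit b)%:A /\
  @tmul K B (tmap idfun S (comul b)) = (counit b)%:A.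

Definition is_hopf : Prop := is_bialgebra /\ exists S, is_antipode S.

End HopfAlgebra.

Section Gradings.
Variable K : fieldType.

(* The subspaces G n form a direct sum decomposition of U. *)
Record is_grading (U : lmodType K) (G : nat -> set U) : Prop := IsGrading {
  grading_sub : forall n, subspace (G n);
  grading_span : forall u, exists (N : nat) (f : nat -> U),
    (forall n, G n (f n)) /\ u = \sum_(n < N) f n;
  grading_free : forall (N : nat) (f : nat -> U), (forall n, G n (f n)) ->
    \sum_(n < N) f n = 0 -> forall n, (n < N)%N -> f n = 0
}.

Definition is_pos_grading (U : lmodType K) (G : nat -> set U) : Prop :=
  is_grading G /\ forall u, G 0%N u -> u = 0.

(* sdeg G n s: s is a sequence of homogeneous elements of total degree n. *)
Inductive sdeg (L : Type) (G : nat -> set L) : nat -> seq L -> Prop :=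
| sdeg_nil : sdeg G 0 [::]
| sdeg_cons n k a s : G n a -> sdeg G k s -> sdeg G (n + k) (a :: s).

(* Gradings of presented algebras: the degree n part is spanned by the words of
   homogeneous generators whose degrees add up to n. *)
Definition tensalg_grading (V : lmodType K) (G : nat -> set V) (n : nat) :
    set (tensalg V) :=
  lspan [set x | exists2 w, sdeg G n (wseq w) & x = tword w].

Definition letter_grading (I : Type) (A : I -> nualgType K)
    (G : forall i, nat -> set (A i)) (n : nat) : set (letter A) :=
  [set a | G (projT1 a) n (projT2 a)].

Definition fprod_grading (I : Type) (A : I -> nualgType K)
    (G : forall i, nat -> set (A i)) (n : nat) : set (fprod A) :=
  lspan [set x | exists2 w, sdeg (letter_grading G) n (wseq w) & x = fword w].

Definition pow_grading (d : nat) (U : lmodType K) (G : nat -> set U) (n : nat) :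
    set {ffun 'I_d -> U} :=
  [set x | forall k, G n (x k)].

Definition sym_grading (W : lmodType K) (G : nat -> set W) (n : nat) :
    set (Sym W) :=
  lspan [set x | exists2 s, sdeg G n s & x = sword s].

(* Degree n part: the sum of the G k (x) H (n - k), 0 <= k <= n. *)
Definition tens_grading (U V : lmodType K) (G : nat -> set U)
    (H : nat -> set V) (n : nat) : set (tens U V) :=
  lspan [set x | exists k u v,
    [/\ (k <= n)%N, G k u, H (n - k)%N v & x = tpure u v]].

Record is_alg_grading (B : algType K) (G : nat -> set B) : Prop :=
  IsAlgGrading {
    alg_grading_dsum : is_grading G;
    alg_grading1 : G 0%N 1;
    alg_gradingM : forall n k a b, G n a -> G k b -> G (n + k)%N (a * b)
  }.

Definition is_graded_hopf (B : algType K) (comul : {lrmorphism B -> tens B B})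
    (counit : {lrmorphism B -> K^o}) (G : nat -> set B) : Prop :=
  [/\ is_hopf comul counit, is_alg_grading G &
      forall n b, G n b -> tens_grading G G n (comul b)].

End Gradings.

Section LHopf.
Variables (K : fieldType) (d m : nat) (V : lmodType K).

Lemma Delta_gen_linear :
  linear (fun v : V => in1 (tensalg V) (tensalg V) (tgen v) +
                       in2 (tensalg V) (tensalg V) (tgen v)).
Proof.
move=> c u v; rewrite (tgen_linear c u v) !linearP.
by rewrite scalerDr addrACA.
Qed.

Definition Delta_gen : {linear V -> fprod2 (tensalg V) (tensalg V)} :=
  HB.pack (fun v : V => in1 (tensalg V) (tensalg V) (tgen v) +
                        in2 (tensalg V) (tensalg V) (tgen v))
    (GRing.isLinear.Build K V (fprod2 (tensalg V) (tensalg V)) _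
      (fun v : V => in1 (tensalg V) (tensalg V) (tgen v) +
                    in2 (tensalg V) (tensalg V) (tgen v)) Delta_gen_linear).

Definition Delta : nuhom (tensalg V) (fprod2 (tensalg V) (tensalg V)) :=
  tensalg_lift Delta_gen.

(* D: the free product of m copies of T(V). *)
Definition Dalg : facedAlg K m := faced_copies (fun _ : 'I_m => tensalg V).

Definition Dcopy (l : 'I_m) : nuhom (tensalg V) Dalg :=
  fin (fun _ : 'I_m => tensalg V) l.

Definition Delta_m : nuhom Dalg (fprod2 Dalg Dalg) :=
  fcase (fun l => nucomp (map2 (Dcopy l) (Dcopy l)) Delta).

Definition Lalg : comAlgType K := Sym {ffun 'I_d -> Dalg}.

Definition Lcomul (sigma : {linear {ffun 'I_d -> fprod2 Dalg Dalg} ->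
      tens (Sym {ffun 'I_d -> Dalg}) (Sym {ffun 'I_d -> Dalg})}) :
    {lrmorphism Lalg -> tens Lalg Lalg} :=
  sym_lift (sigma \o powmap Delta_m).

Definition Lcounit : {lrmorphism Lalg -> K^o} :=
  sym_lift (\0 : {linear {ffun 'I_d -> Dalg} -> K^o}).

Definition Lgrading (G : nat -> set V) : nat -> set Lalg :=
  sym_grading (pow_grading (fprod_grading (fun _ : 'I_m => tensalg_grading G))).

End LHopf.

(* Main.v *)
Require Import Defs.
From HB Require Import structures.
From mathcomp Require Import all_boot all_order all_algebra.
From mathcomp Require Import boolp classical_sets reals complex.

(* All identities are tested against functionals.  Over an infinite field the
   characters S(phi), phi in (D^d)^*, separate the points of S(D^d) (project the
   generators along one of them and use that a polynomial vanishing everywhere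
   is zero), hence their products separate the points of the tensor powers.  The
   definition of sigma says that (S(phi) (x) S(psi)) o comul = S(phi * psi) with
   phi * psi = (phi (.) psi) o Delta^m, so that coassociativity, counit and
   compatibility with the grading become statements on *, which follow from the
   associativity, unitality and universality of (.).

   A grading is handled through the operators theta_c, c in K, multiplying degree
   n by c ^ n: by a Vandermonde argument they detect homogeneity, and they are
   transported functorially through T, the free product, powers, S and (x).
   Universality of (.) makes comul commute with them.

   As V lives in positive degrees, the degree 0 part of S(D^d) is K 1, so the
   series of (-1)^k (id - unit o counit)^{* k} is finite on every element, and its
   sum is the antipode. *)

Set Implicit Arguments.
Unset Strict Implicit.
Unset Printing Implicit Defensive.

Import GRing.Theory.
Local Open Scope ring_scope.

(** * Separation of points *)

(** Leibniz equality, by functional extensionality and proof irrelevance, so that linear maps can be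
    replaced inside [tmap], [conv] and [symev]. *)
Lemma linear_ext (K : fieldType) (U V : lmodType K) (f g : {linear U -> V}) :
  f =1 g -> f = g.
Proof.
move=> /funext fg; case: f g fg => [f [[a1] [a2]]] [g [[b1] [b2]]] /= fg.
move: a1 a2 b1 b2; rewrite fg => a1 a2 b1 b2.
by rewrite (Prop_irrelevance a1 b1) (Prop_irrelevance a2 b2).
Qed.

(** * Functionals on tensor products *)

Section TensorSeparation.
Variable K : fieldType.

Definition separating (U : lmodType K) (F : set {linear U -> K^o}) : Prop :=
  forall u, (forall f, F f -> f u = 0) -> u = 0.

Lemma separatingT (U : lmodType K) : separating (@setT {linear U -> K^o}).
Proof.
move=> u f0; apply/eqP; apply: contrapT => /negP/functional_at[f fu].
by have := oner_neq0 K; rewrite -fu f0 // eqxx.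
Qed.

HB.instance Definition _ (U V : lmodType K) (u : U) :=
  GRing.isLinear.Build K V (tens U V) _ (tpure u) (@tpure_linr K U V u).

Lemma tpureDl (U V : lmodType K) (v : V) (x y : U) :
  tpure (x + y) v = tpure x v + tpure y v.
Proof. by have := tpure_linl v 1 x y; rewrite !scale1r. Qed.

Lemma tpureZl (U V : lmodType K) (v : V) c (x : U) :
  tpure (c *: x) v = c *: tpure x v.
Proof. exact: (linearZ_LR (@tpure_r K U V v)). Qed.

Lemma tpure0l (U V : lmodType K) (v : V) : tpure (0 : U) v = 0.
Proof. by rewrite -[X in tpure X](scale0r 0) tpureZl scale0r. Qed.

Lemma tens_sum (U V : lmodType K) (p : tens U V) :
  exists s : seq (U * V), p = \sum_(x <- s) tpure x.1 x.2.
Proof.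
elim/tens_ind: p => [|u v|_ _ [s ->] [t ->]|c _ [s ->]].
- by exists [::]; rewrite big_nil.
- by exists [:: (u, v)]; rewrite big_seq1.
- by exists (s ++ t); rewrite big_cat.
- exists [seq (c *: x.1, x.2) | x <- s]; rewrite big_map scaler_sumr.
  by apply: eq_bigr => x _ /=; rewrite tpureZl.
Qed.

(* If [g y = 1], replacing the other [y'] by [y' - g y' *: y] turns the left
   factor of [y] into [(id (x) g) p], which vanishes: one summand is saved. *)
Lemma tens_sum_separated (U V : lmodType K) (s : seq (U * V)) :
  (forall g : {linear V -> K^o}, \sum_(x <- s) g x.2 *: x.1 = 0) ->
  \sum_(x <- s) tpure x.1 x.2 = 0.
Proof.
elim: {s}(size s) {-2}s (erefl (size s)) => [|n IH] [|[u v] s] //= sn Hs.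
  by rewrite big_nil.
have [v0|/functional_at[g gv]] := eqVneq v 0.
  rewrite big_cons /= v0 linear0 add0r; apply: IH => [|g]; first by case: sn.
  by have := Hs g; rewrite big_cons /= v0 linear0 scale0r add0r.
pose t := [seq (x.1, x.2 - g x.2 *: v) | x <- s].
have uE : u = - \sum_(x <- s) g x.2 *: x.1.
  by have := Hs g; rewrite big_cons /= gv scale1r => /eqP; rewrite addr_eq0 => /eqP.
have -> : \sum_(x <- (u, v) :: s) tpure x.1 x.2 = \sum_(x <- t) tpure x.1 x.2.
  rewrite big_cons /= big_map uE -sumrN.
  rewrite -[tpure _ v]/(tpure_r v _) linear_sum /=.
  rewrite -big_split; apply: eq_bigr => x _ /=.
  rewrite linearN linearB linearZ_LR /= /tpure_r addrC; congr (_ - _).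
  by rewrite linearZ_LR.
apply: IH => [|h]; first by rewrite size_map; case: sn.
rewrite big_map /=.
have -> : \sum_(x <- s) h (x.2 - g x.2 *: v) *: x.1 =
    \sum_(x <- (u, v) :: s) h x.2 *: x.1 -
    h v *: \sum_(x <- (u, v) :: s) g x.2 *: x.1.
  rewrite !big_cons /= gv scale1r scalerDr opprD addrACA subrr add0r.
  rewrite scaler_sumr -sumrB; apply: eq_bigr => x _.
  by rewrite linearB linearZ_LR scalerBl scalerA mulrC.
by rewrite !Hs scaler0 subrr.
Qed.

Definition tprod (U V : lmodType K) (f : {linear U -> K^o})
    (g : {linear V -> K^o}) : {linear tens U V -> K^o} :=
  @tmul K K^o \o tmap f g.

Lemma tprodE (U V : lmodType K) (f : {linear U -> K^o})
    (g : {linear V -> K^o}) u v : tprod f g (tpure u v) = f u * g v.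
Proof.
have -> : tprod f g (tpure u v) = @tmul K K^o (tmap f g (tpure u v)) by [].
by rewrite (tmapE f g) (@tmulE K K^o).
Qed.

(** Slicing twice. For [f] in [F], the slice [(f (x) id) p] is killed by all of [G], hence is zero.
    Applying an arbitrary [g] to it shows that [(id (x) g) p] is killed by all of [F], hence is
    zero, which is the hypothesis of [tens_sum_separated]. *)
Lemma tens_separating (U V : lmodType K) (F : set {linear U -> K^o})
    (G : set {linear V -> K^o}) :
  separating F -> separating G ->
  separating [set h | exists f g, [/\ F f, G g & h = tprod f g]]%classic.
Proof.
move=> sepF sepG p Hp; have [s sE] := tens_sum p; rewrite sE.
apply: tens_sum_separated => g; apply: sepF => f Ff.
have y0 : \sum_(x <- s) f x.1 *: x.2 = 0.
  apply: sepG => h Gh; have := Hp (tprod f h); rewrite sE linear_sum => Hs.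
  rewrite linear_sum -[RHS]Hs; last by exists f, h.
  by apply: eq_bigr => x _; rewrite tprodE linearZ_LR.
have := congr1 g y0; rewrite linear0 linear_sum => gy0; rewrite -[RHS]gy0.
rewrite linear_sum; apply: eq_bigr => x _.
by rewrite !linearZ_LR; exact: mulrC.
Qed.

End TensorSeparation.

(** * Polynomial identities over an infinite field *)

Section InfiniteField.
Variable K : fieldType.
Hypothesis Kinf : forall p : {poly K}, (forall x, p.[x] = 0) -> p = 0.

Lemma vandermonde (U : lmodType K) (N : nat) (f : nat -> U) :
  (forall c : K, \sum_(n < N) c ^+ n *: f n = 0) ->
  forall n, (n < N)%N -> f n = 0.
Proof.
move=> f0 n nN; apply: (@separatingT K U) => g _.
have /(congr1 (coefp n)) : \poly_(i < N) (g (f i) : K) = 0.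
  apply: Kinf => c; rewrite horner_poly -[RHS](linear0 g) -(f0 c) linear_sum.
  by apply: eq_bigr => i _; rewrite linearZ_LR; exact: mulrC.
by rewrite /= coef_poly nN coef0.
Qed.

(** * Characters of symmetric algebras *)

Section SymSeparation.
Variable W : lmodType K.

(** The unital subalgebra generated by the list [s]. Every element lies in one, so induction on the
    length of [s] is available without choosing a basis of [W]. *)
Definition sym_sub (s : seq W) : set (Sym W) :=
  lspan [set sword t | t in [set t : seq W | {subset t <= s}]]%classic.

Lemma sym_sub_all (u : Sym W) : exists s, sym_sub s u.
Proof.
have mono s t : {subset s <= t} -> (sym_sub s `<=` sym_sub t)%classic.
  move=> st; apply: lspan_mono => _ [r rs <-]; exists r => //= x /rs; exact: st.
elim/Sym_ind: u => [|s|p q [s sp] [t tq]|c p [s sp]].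
- by exists [::]; left.
- by exists s; apply: lspan_sub; exists s => //= x.
- exists (s ++ t); rewrite -[p]scale1r; apply: (lspan_subspace _).2.
    by apply: mono sp => x; rewrite mem_cat => ->.
  by apply: mono tq => x; rewrite mem_cat orbC => ->.
- exists s; rewrite -[_ *: _]addr0; apply: (lspan_subspace _).2 => //.
  by left.
Qed.

Lemma sym_sub_nil u : sym_sub [::] u -> exists c, u = c *: 1.
Proof.
elim=> [|c x y [t t0 <-] _ [a ->]]; first by exists 0; rewrite scale0r.
case: t t0 => [|w t] t0; last by have := t0 w; rewrite mem_head => /(_ isT).
by exists (c + a); rewrite scalerDl.
Qed.

Lemma sym_sub1 s : sym_sub s 1.
Proof. by apply: lspan_sub; exists [::]. Qed.

Lemma sym_subDZ s c x y : sym_sub s x -> sym_sub s y -> sym_sub s (c *: x + y).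
Proof. exact: (lspan_subspace _).2. Qed.

Lemma sym_sub_mulg s w x : w \in s -> sym_sub s x -> sym_sub s (sgen w * x).
Proof.
move=> ws; elim=> [|c u v [t ts <-] _ IH]; first by rewrite mulr0; left.
rewrite mulrDr -scalerAr; apply: sym_subDZ => //; apply: lspan_sub.
exists (w :: t); first by move=> y; rewrite inE => /orP[/eqP->|/ts].
by rewrite -cat1s -[LHS]swordM.
Qed.

Lemma sgenZD c (u v : W) : sgen (c *: u + v) = c *: sgen u + sgen v.
Proof. exact: sgen_linear. Qed.

(** For linear [g] with [g v = 1], the projection along [v] onto the kernel of [g]. *)
Definition sproj (g : W -> K) (v w : W) : W := w - g w *: v.

(** Expand each letter as [w = g w *: v + sproj g v w] and collect the powers of [v]; the
    coefficients then involve the projected letters only. *)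
Lemma sym_sub_poly g v s u : sym_sub (v :: s) u ->
  exists2 q : {poly Sym W},
    forall k, sym_sub [seq sproj g v w | w <- s] q`_k & u = q.[sgen v].
Proof.
set s' := map _ _.
have DZ c (q r : {poly Sym W}) : (forall k, sym_sub s' q`_k) ->
    (forall k, sym_sub s' r`_k) -> forall k, sym_sub s' (c%:A%:P * q + r)`_k.
  move=> Hq Hr k; rewrite coefD coefCM mulr_algl; exact: sym_subDZ.
have X (q : {poly Sym W}) : (forall k, sym_sub s' q`_k) ->
    forall k, sym_sub s' (q * 'X)`_k.
  by move=> Hq [|k]; rewrite coefMX //=; left.
elim=> [|c x y [t ts <-] _ [r Hr ->]].
  by exists 0 => [k|]; rewrite ?coef0 ?horner0 //; left.
suff [q Hq ->] : exists2 q : {poly Sym W},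
    forall k, sym_sub s' q`_k & sword t = q.[sgen v].
  exists (c%:A%:P * q + r); first exact: DZ.
  by rewrite hornerD hornerCM mulr_algl.
elim: t ts => [|w t IH] ts.
  exists 1; last by rewrite hornerC.
  by case=> [|k]; rewrite coef1 /=; [exact: sym_sub1|left].
have [|q Hq tE] := IH; first by move=> x0 x0t; apply: ts; rewrite inE x0t orbT.
have wE : sword (w :: t) = sgen w * sword t by rewrite -cat1s [RHS]swordM.
have := ts w; rewrite mem_head inE => /(_ isT) /orP[/eqP wv|ws].
  exists (q * 'X); first exact: X.
  by rewrite hornerMX -tE wE wv mulrC.
exists (((g w)%:A : Sym W)%:P * (q * 'X) + (sgen (sproj g v w))%:P * q).
  apply: DZ; first exact: X.
  by move=> k; rewrite coefCM; apply: sym_sub_mulg => //; exact: map_f.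
rewrite hornerD !hornerCM hornerMX -tE wE mulr_algl.
have {1}-> : w = g w *: v + sproj g v w by rewrite addrC subrK.
by rewrite sgenZD mulrDl -scalerAl [sgen v * _]mulrC.
Qed.

Lemma sproj_linear (g : {linear W -> K^o}) v : linear (sproj g v).
Proof.
move=> c x y; rewrite /sproj linearP scalerBr scalerA addrACA scalerDl opprD.
by rewrite -scalerA scalerA.
Qed.

HB.instance Definition _ (g : {linear W -> K^o}) v :=
  GRing.isLinear.Build K W W _ (sproj g v) (sproj_linear g v).

Definition symev (f : {linear W -> K^o}) : {linear Sym W -> K^o} := sym_lift f.

Lemma symev1 f : symev f 1 = 1.
Proof. exact: (rmorph1 (sym_lift f)). Qed.

Lemma symevM f x y : symev f (x * y) = symev f x * symev f y.
Proof. exact: (rmorphM (sym_lift f)). Qed.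

Lemma symevX f x n : symev f (x ^+ n) = symev f x ^+ n.
Proof. exact: (rmorphXn (sym_lift f)). Qed.

Lemma symevE f w : symev f (sgen w) = f w.
Proof. exact: sym_liftE. Qed.

Lemma symev_word f t : symev f (sword t) = \prod_(w <- t) f w.
Proof. exact: sym_lift_word. Qed.

Lemma symev_eq_on (f h : {linear W -> K^o}) s u :
  {in s, f =1 h} -> sym_sub s u -> symev f u = symev h u.
Proof.
move=> fh; elim=> [|c x y [t ts <-] _ IH]; first by rewrite !linear0.
rewrite !linearP IH !symev_word; congr (_ *: _ + _).
by apply: eq_big_seq => w /ts /fh.
Qed.

(** Induction on the number of generators. With [u] written as a polynomial [q] in [v], letting the
    value at [v] vary shows that every character kills every coefficient of [q]; these use one
    generator less. *)
Lemma sym_separating : separating (range symev).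
Proof.
move=> u Hu; have {Hu} u0 f : symev f u = 0 by apply: Hu; exists f.
have [s su] := sym_sub_all u.
elim: {s}(size s) {-2}s (erefl (size s)) u u0 su => [|n IH] [|v s] //= sn u u0 su.
  have [c uc] := sym_sub_nil su; have := u0 \0.
  rewrite uc [LHS](linearZ_LR (symev \0)) symev1.
  by rewrite [_ *: _]mulr1 => ->; rewrite scale0r.
have [v0|/functional_at[g gv]] := eqVneq v 0.
  (* For [v = 0] there is no [g] with [g v = 1]. With [g = 0] the other letters are unchanged, and
     evaluating [q] at [sgen 0 = 0] leaves its constant coefficient. *)
  have [q Hq uE] := sym_sub_poly (fun=> 0) su.
  have sg0 : sgen (0 : W) = 0.
    by have := sgenZD (-1) (0 : W) 0; rewrite scaler0 addr0 scaleN1r addNr.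
  have s1E : [seq sproj (fun=> 0) v w | w <- s] = s.
    by rewrite -[RHS]map_id; apply: eq_map => w; rewrite /sproj v0 scaler0 subr0.
  apply: (IH s) => //; first by case: sn.
  by move: uE; rewrite v0 sg0 horner_coef0 => ->; rewrite -[X in sym_sub X]s1E.
have [q Hq uE] := sym_sub_poly g su.
rewrite uE horner_coef big1 // => i _.
suff -> : q`_i = 0 by rewrite mul0r.
apply: (IH [seq sproj g v w | w <- s]) => //; first by rewrite size_map; case: sn.
move=> f.
(* [h t] takes the value [t] at [v] and agrees with [f] on the projected letters, so [symev (h t) u]
   is a polynomial in [t] with coefficients [symev f q_k]. *)
pose h t : {linear W -> K^o} := (f \o sproj g v) \+ (t \*: g).
apply: (vandermonde (f := fun k => symev f q`_k)  _ (ltn_ord i)) => t.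
rewrite -[RHS](u0 (h t)) uE horner_coef [RHS](linear_sum (symev (h t))).
apply: eq_bigr => k _.
have hv : h t v = t.
  by rewrite /h /= /sproj gv scale1r subrr linear0 add0r [_ *: _]mulr1.
rewrite symevM symevX symevE hv; rewrite [LHS]mulrC; congr (_ * _).
apply: symev_eq_on (Hq k) => _ /mapP[w _ ->].
have gw : g (sproj g v w) = 0.
  by rewrite /sproj linearB linearZ_LR /= gv [_ *: 1]mulr1 subrr.
have -> x : h t x = f (sproj g v x) + t * g x by [].
rewrite [X in t * X]gw mulr0 addr0; congr (f _).
by rewrite [RHS]/sproj [X in X *: v]gw scale0r subr0.
Qed.
End SymSeparation.

End InfiniteField.

(** * Gradings *)

Section Spans.
Variable K : fieldType.

Lemma lspanD (U : lmodType K) (P : set U) u v :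
  lspan P u -> lspan P v -> lspan P (u + v).
Proof. by rewrite -{2}[u]scale1r; exact: (lspan_subspace P).2. Qed.

Lemma lspanZ (U : lmodType K) (P : set U) c u : lspan P u -> lspan P (c *: u).
Proof.
move=> Pu; rewrite -[_ *: _]addr0; apply: (lspan_subspace P).2 => //.
by left.
Qed.

Lemma lspan_sum (U : lmodType K) (P : set U) (I : Type) (r : seq I) (f : I -> U) :
  (forall i, lspan P (f i)) -> lspan P (\sum_(i <- r) f i).
Proof. by move=> Pf; apply: big_ind => //; [left|exact: lspanD]. Qed.

Lemma lspan_image (U V : lmodType K) (P : set U) (Q : set V)
    (f : {linear U -> V}) u :
  (forall x, P x -> lspan Q (f x)) -> lspan P u -> lspan Q (f u).
Proof.
move=> PQ; elim=> [|c x y Px _ IH]; first by rewrite linear0; left.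
by rewrite linearP; apply: (lspan_subspace Q).2 => //; exact: PQ.
Qed.

Lemma lspan_eq_on (U V : lmodType K) (P : set U) (f g : {linear U -> V}) u :
  (forall x, P x -> f x = g x) -> lspan P u -> f u = g u.
Proof.
move=> fg; elim=> [|c x y Px _ IH]; first by rewrite !linear0.
by rewrite !linearP IH fg.
Qed.

Lemma lspan_eq0 (U : lmodType K) (P : set U) u :
  (forall x, P x -> x = 0) -> lspan P u -> u = 0.
Proof. by move=> P0; elim=> [//|c x y /P0-> _ ->]; rewrite scaler0 addr0. Qed.

Lemma lspan_bilinear (U V W : lmodType K) (P : set U) (Q : set V) (R : set W)
    (b : U -> V -> W) u v :
  (forall v, linear (b^~ v)) -> (forall u, linear (b u)) ->
  (forall x y, P x -> Q y -> lspan R (b x y)) ->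
  lspan P u -> lspan Q v -> lspan R (b u v).
Proof.
move=> bl br PQR Pu Qv.
pose f v := HB.pack_for {linear U -> W} (b^~ v)
  (GRing.isLinear.Build K U W _ (b^~ v) (bl v)).
pose g u := HB.pack_for {linear V -> W} (b u)
  (GRing.isLinear.Build K V W _ (b u) (br u)).
apply: (lspan_image (f := f v)) Pu => x Px.
by apply: (lspan_image (f := g x)) Qv => y; exact: PQR.
Qed.

Lemma lspan_numul (A : nualgType K) (P Q R : set A) x y :
  (forall x y, P x -> Q y -> lspan R (numul x y)) ->
  lspan P x -> lspan Q y -> lspan R (numul x y).
Proof.
apply: lspan_bilinear => u c a b; first exact: numulDZl.
exact: numulDZr.
Qed.

End Spans.

(** * Scaling operators of a grading *)

Section Gradings.
Variable K : fieldType.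

Definition homogeneous (U : lmodType K) (G : nat -> set U) : set U :=
  [set u | exists n, G n u]%classic.

(* A grading is encoded by the operators [theta c] acting as [c ^+ n] in degree
   [n]; over an infinite field they determine the homogeneous components. *)
Record scaled_by (U : lmodType K) (G : nat -> set U)
    (theta : K -> {linear U -> U}) : Prop := ScaledBy {
  scaled_sub : forall n, subspace (G n);
  scaled_span : forall u, lspan (homogeneous G) u;
  scaledE : forall c n u, G n u -> theta c u = c ^+ n *: u
}.

(* The graph of [theta c]: linearity and totality need no uniqueness of the
   decomposition, which only enters in [grading_scaled_by]. *)
Definition scaling_graph (U : lmodType K) (G : nat -> set U) (c : K) (u v : U) :=
  exists (f : nat -> U) (N : nat), (forall n, G n (f n)) /\
    forall M, (N <= M)%N ->
      u = \sum_(n < M) f n /\ v = \sum_(n < M) c ^+ n *: f n.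

Section ScalingGraph.
Variables (U : lmodType K) (G : nat -> set U).
Hypothesis Gsub : forall n, subspace (G n).

Lemma scaling_graph0 c : scaling_graph G c 0 0.
Proof.
exists (fun=> 0), 0%N; split=> [n|M _]; first exact: (Gsub n).1.
by split; rewrite big1 // => i _; rewrite scaler0.
Qed.

Lemma scaling_graph_homog c n u : G n u -> scaling_graph G c u (c ^+ n *: u).
Proof.
move=> Gu; exists (fun k => if k == n then u else 0), n.+1; split=> [k|M nM].
  by have [->//|_] := eqVneq; exact: (Gsub k).1.
split; rewrite (bigD1 (Ordinal nM)) //= eqxx big1 ?addr0 // => i;
  by rewrite -val_eqE /= => /negPf->; rewrite ?scaler0.
Qed.

Lemma scaling_graph_linear c a u v x y :
  scaling_graph G c u v -> scaling_graph G c x y ->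
  scaling_graph G c (a *: u + x) (a *: v + y).
Proof.
move=> [f [N [Gf fE]]] [g [N' [Gg gE]]].
(* Both decompositions are valid for every large enough bound, so they can be added at a common
   one. *)
exists (fun n => a *: f n + g n), (maxn N N'); split=> [n|M].
  exact: (Gsub n).2.
rewrite geq_max => /andP[/fE[-> ->] /gE[-> ->]].
split; rewrite scaler_sumr -big_split //=; apply: eq_bigr => i _.
by rewrite scalerDr !scalerA mulrC.
Qed.

Lemma scaling_graph_total c u :
  lspan (homogeneous G) u -> exists v, scaling_graph G c u v.
Proof.
elim=> [|a x y [n Gx] _ [v vy]]; first by exists 0; exact: scaling_graph0.
exists (a *: (c ^+ n *: x) + v); apply: scaling_graph_linear => //.
exact: scaling_graph_homog.
Qed.

Lemma homogeneous_sum u : lspan (homogeneous G) u ->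
  exists (f : nat -> U) (N : nat), (forall n, G n (f n)) /\
    forall M, (N <= M)%N -> u = \sum_(n < M) f n.
Proof.
move=> /(scaling_graph_total 1)[v [f [N [Gf fE]]]].
by exists f, N; split=> // M /fE[].
Qed.

End ScalingGraph.

Lemma grading_homogeneous (U : lmodType K) (G : nat -> set U) :
  is_grading G -> forall u, lspan (homogeneous G) u.
Proof.
move=> Ggr u; have [N [f [Gf ->]]] := grading_span Ggr u.
by apply: lspan_sum => i; apply: lspan_sub; exists i.
Qed.

(** Independence of the homogeneous parts makes the graph of [theta c] single-valued; choice turns
    it into a function, whose linearity comes from that of the graph. *)
Lemma grading_scaled_by (U : lmodType K) (G : nat -> set U) :
  is_grading G -> exists theta, scaled_by G theta.
Proof.
move=> Ggr; have Gsub := grading_sub Ggr.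
have uniq c u v w : scaling_graph G c u v -> scaling_graph G c u w -> v = w.
  move=> [f [N [Gf fE]]] [g [N' [Gg gE]]].
  have [uf ->] := fE _ (leq_maxl N N'); have [ug ->] := gE _ (leq_maxr N N').
  have fg0 : \sum_(n < maxn N N') (f n - g n) = 0 by rewrite sumrB -uf -ug subrr.
  apply: eq_bigr => i _; congr (_ *: _); apply/eqP; rewrite -subr_eq0; apply/eqP.
  apply: (grading_free Ggr (f := fun n => f n - g n)) fg0 _ _ => // n.
  by rewrite addrC -scaleN1r; apply: (Gsub n).2.
have ex c u := scaling_graph_total Gsub c (grading_homogeneous Ggr u).
pose th c u := sval (cid (ex c u)).
have thP c u : scaling_graph G c u (th c u) by exact: svalP (cid (ex c u)).
have th_lin c : linear (th c).
  move=> a u v; apply: uniq (thP _ _) _; exact: scaling_graph_linear.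
exists (fun c => HB.pack_for {linear U -> U} (th c)
  (GRing.isLinear.Build K U U _ (th c) (th_lin c))).
split=> // [u|c n u Gu]; first exact: grading_homogeneous.
by apply: uniq (thP _ _) _; exact: scaling_graph_homog.
Qed.

Lemma wprod_scaled (L : Type) (A : nualgType K) (G : nat -> set L)
    (f g : L -> A) (c : K) n w :
  (forall n a, G n a -> f a = c ^+ n *: g a) -> sdeg G n (wseq w) ->
  wprod f w = c ^+ n *: wprod g w.
Proof.
move=> fg; elim: w n => [a|a w IH] n /= sw; inversion_clear sw.
  by inversion_clear H0; rewrite addn0; exact: fg.
by rewrite (fg _ _ H) (IH _ H0) numulZl numulZr scalerA exprD.
Qed.

Lemma sdeg_cat (L : Type) (G : nat -> set L) n k s t :
  sdeg G n s -> sdeg G k t -> sdeg G (n + k) (s ++ t).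
Proof. by elim=> [//|i j a {}s Ga _ IH /IH ?]; rewrite -addnA; constructor. Qed.

Lemma wseq_cat (L : Type) (v w : word L) : wseq (wcat v w) = wseq v ++ wseq w.
Proof. by elim: v => //= a v ->. Qed.

Lemma wprod_span (L : Type) (A : nualgType K) (H : nat -> set A) (g : L -> A) w :
  (forall n k x y, H n x -> H k y -> H (n + k)%N (numul x y)) ->
  (forall a, lspan (homogeneous H) (g a)) ->
  lspan (homogeneous H) (wprod g w).
Proof.
move=> HM Hg; elim: w => [a|a w IH] //=.
apply: lspan_numul (Hg a) IH => x y [n Hx] [k Hy].
by apply: lspan_sub; exists (n + k)%N; exact: HM.
Qed.

(** Degrees are natural numbers, so total degree 0 forces degree 0 on each letter. The first letter
    suffices: if it is zero, the whole product vanishes. *)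
Lemma sdeg0 (L : Type) (G : nat -> set L) n w : sdeg G n (wseq w) -> n = 0%N ->
  exists a, G 0%N a /\ (w = WLetter a \/ exists w', w = WCons a w').
Proof.
case: w => [a|a w] /= sw; inversion_clear sw => /eqP.
  by rewrite addn_eq0 => /andP[/eqP <- _]; exists a; split=> //; left.
rewrite addn_eq0 => /andP[/eqP <- _]; exists a; split=> //; right.
by exists w.
Qed.

End Gradings.

(** * From scaling operators back to gradings *)

Section ScaledGradings.
Variable K : fieldType.
Hypothesis Kinf : forall p : {poly K}, (forall x, p.[x] = 0) -> p = 0.

(** Applying [theta c] to a relation among homogeneous elements gives [\sum_n c ^+ n *: f n = 0] for
    all [c], whence independence by [vandermonde]. *)
Lemma scaled_by_grading (U : lmodType K) (G : nat -> set U)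
    (theta : K -> {linear U -> U}) :
  scaled_by G theta -> is_grading G.
Proof.
move=> Gth; split=> [|u|N f Gf f0]; first exact: scaled_sub Gth.
  have [f [N [Gf fE]]] := homogeneous_sum (scaled_sub Gth) (scaled_span Gth u).
  by exists N, f; split=> //; exact: fE.
apply: (vandermonde Kinf) => c.
rewrite -[RHS](linear0 (theta c)) -[in RHS]f0 linear_sum.
by apply: eq_bigr => i _; rewrite (scaledE Gth _ (Gf i)).
Qed.

(** Comparing [\sum_k c ^+ k *: f k] with [c ^+ n *: u] for all [c] identifies [u] with its
    component [f n]. *)
Lemma scaled_by_homogeneous (U : lmodType K) (G : nat -> set U)
    (theta : K -> {linear U -> U}) n u :
  scaled_by G theta -> (forall c, theta c u = c ^+ n *: u) -> G n u.
Proof.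
move=> Gth thu.
have [f [N [Gf fE]]] := homogeneous_sum (scaled_sub Gth) (scaled_span Gth u).
(* The bound exceeds [n], so that the component of index [n] occurs in the sum even if it is
   zero. *)
pose M := maxn N n.+1; have uE := fE M (leq_maxl _ _).
have nM : (n < M)%N := leq_maxr _ _.
suff : f n - (if n == n then u else 0) = 0 by rewrite eqxx => /subr0_eq <-.
apply: (vandermonde Kinf (f := fun k => f k - (if k == n then u else 0)) _ nM).
move=> c.
have -> : \sum_(k < M) c ^+ k *: (f k - (if k == n :> nat then u else 0)) =
    \sum_(k < M) theta c (f k) - c ^+ n *: u.
  rewrite (bigD1 (Ordinal nM)) //= [in RHS](bigD1 (Ordinal nM)) //= eqxx.
  rewrite scalerBr (scaledE Gth _ (Gf n)) addrAC; congr (_ + _ - _).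
  apply: eq_bigr => i; rewrite -val_eqE /= => /negPf->.
  by rewrite subr0 (scaledE Gth _ (Gf i)).
by rewrite -linear_sum -uE thu subrr.
Qed.

End ScaledGradings.

(** * Scaling operators on tensor algebras, free products, powers, symmetric algebras and tensor
    products *)

Section ScaledConstructions.
Variable K : fieldType.

Section TensorAlgebra.
Variables (V : lmodType K).

HB.instance Definition _ :=
  GRing.isLinear.Build K V (tensalg V) _ (@tgen K V) (@tgen_linear K V).

Definition tensalg_map (f : {linear V -> V}) : nuhom (tensalg V) (tensalg V) :=
  tensalg_lift (@tgen K V \o f).

Lemma tensalg_map_gen f v : tensalg_map f (tgen v) = tgen (f v).
Proof. exact: tensalg_liftE. Qed.

Variables (G : nat -> set V) (theta : K -> {linear V -> V}).
Hypothesis Gth : scaled_by G theta.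

(** The operators extend by the universal property, and the powers of [c] multiply along words.
    Independence of the spans of homogeneous words, hard to read off a presentation, then follows
    from [scaled_by_grading]. *)
Lemma tensalg_scaled_by :
  scaled_by (tensalg_grading G) (fun c => tensalg_map (theta c)).
Proof.
split=> [n|u|c n u]; first exact: lspan_subspace.
- elim/sgalg_ind: u => [|w|p q|c p]; first by left.
  + rewrite -[sggen _ _ w]/(tword w) tword_prod; apply: wprod_span.
      move=> n k x y; apply: lspan_numul => _ _ [v nv ->] [v' kv' ->].
      apply: lspan_sub; exists (wcat v v'); first by rewrite wseq_cat; exact: sdeg_cat.
      exact: sggenM.
    move=> v; apply: (lspan_image (f := @tgen K V)) (scaled_span Gth v) => x [n Gx].
    apply: lspan_sub; exists n; apply: lspan_sub; exists (WLetter x) => //.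
    by rewrite -[n]addn0; repeat constructor.
  + exact: lspanD.
  + exact: lspanZ.
- apply: (lspan_eq_on (f := tensalg_map (theta c)) (g := c ^+ n \*: idfun)).
  move=> _ [w nw ->]; rewrite [LHS]sghomE -[RHS]/(c ^+ n *: tword w) tword_prod.
  apply: wprod_scaled nw => k v Gv /=.
  by rewrite (scaledE Gth _ Gv) linearZ_LR.
Qed.

Lemma tensalg_grading0 : (forall v, G 0%N v -> v = 0) ->
  forall u, tensalg_grading G 0 u -> u = 0.
Proof.
move=> G0 u; apply: lspan_eq0 => _ [w /sdeg0 /(_ erefl)[v [/G0 -> wE]] ->].
rewrite tword_prod; case: wE => [->|[w' ->]] /=; first exact: linear0.
by rewrite linear0 numul0l.
Qed.

End TensorAlgebra.

Section FreeProduct.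
Variables (I : Type) (A : I -> nualgType K).

Lemma fword_prod w :
  fword w = wprod (fun x : letter A => fin A (projT1 x) (projT2 x)) w.
Proof. by elim: w => [[i a]|[i a] w IH] //=; rewrite -IH sggenM. Qed.

Variables (G : forall i, nat -> set (A i)) (theta : forall i, K -> nuhom (A i) (A i)).
Hypothesis Gth : forall i, scaled_by (@G i) (fun c => @theta i c).

Lemma fprod_scaled_by :
  scaled_by (fprod_grading G) (fun c => fmap (fun i => @theta i c)).
Proof.
split=> [n|u|c n u]; first exact: lspan_subspace.
- elim/sgalg_ind: u => [|w|p q|c p]; first by left.
  + rewrite -[sggen _ _ w]/(fword w) fword_prod; apply: wprod_span.
      move=> n k x y; apply: lspan_numul => _ _ [v nv ->] [v' kv' ->].
      apply: lspan_sub; exists (wcat v v'); first by rewrite wseq_cat; exact: sdeg_cat.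
      exact: sggenM.
    move=> [i a] /=; apply: (lspan_image (f := fin A i)) (scaled_span (Gth i) a).
    move=> x [n Gx]; apply: lspan_sub; exists n; apply: lspan_sub.
    exists (WLetter (ltr x)) => //.
    by rewrite -[n]addn0; repeat constructor.
  + exact: lspanD.
  + exact: lspanZ.
- apply: (lspan_eq_on (f := fmap (fun i => @theta i c)) (g := c ^+ n \*: idfun)).
  move=> _ [w nw ->]; rewrite [LHS]sghomE -[RHS]/(c ^+ n *: fword w) fword_prod.
  apply: wprod_scaled nw => k [i a] /= Ga.
  by rewrite /fcase_letter /= (scaledE (Gth i) _ Ga); exact: (linearZ_LR (fin A i)).
Qed.

Lemma fprod_grading0 : (forall i (v : A i), G 0%N v -> v = 0) ->
  forall u, fprod_grading G 0 u -> u = 0.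
Proof.
move=> G0 u; apply: lspan_eq0 => _ [w /sdeg0 /(_ erefl)[[i v] [/G0 /= v0 wE]] ->].
have fin0 : fin_fun (0 : A i) = 0 := linear0 (fin A i).
rewrite fword_prod; case: wE => [->|[w' ->]] /=; rewrite v0 fin0 //.
by rewrite numul0l.
Qed.

End FreeProduct.

Section Power.
Variables (d : nat) (U : lmodType K) (G : nat -> set U).
Variable theta : K -> {linear U -> U}.
Hypothesis Gth : scaled_by G theta.

Definition pow_in (k : 'I_d) (u : U) : {ffun 'I_d -> U} :=
  [ffun j => if j == k then u else 0].

Lemma pow_in_linear k : linear (pow_in k).
Proof.
move=> c u v; apply/ffunP => j; rewrite !ffunE.
by case: eqP => // _; rewrite scaler0 addr0.
Qed.

HB.instance Definition _ k :=
  GRing.isLinear.Build K U {ffun 'I_d -> U} _ (pow_in k) (pow_in_linear k).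

Lemma pow_in_sum (x : {ffun 'I_d -> U}) : x = \sum_k pow_in k (x k).
Proof.
apply/ffunP => j; rewrite sum_ffunE (bigD1 j) //= ffunE eqxx big1 ?addr0 // => k.
by rewrite ffunE eq_sym => /negPf->.
Qed.

Lemma pow_scaled_by :
  scaled_by (pow_grading (d := d) G) (fun c => powmap (d := d) (theta c)).
Proof.
split=> [n|x|c n x Gx].
- split=> [k|c x y Gx Gy k]; first by rewrite ffunE; exact: (scaled_sub Gth n).1.
  by rewrite !ffunE; apply: (scaled_sub Gth n).2.
- rewrite [x]pow_in_sum; apply: lspan_sum => k.
  apply: (lspan_image (f := pow_in k)) (scaled_span Gth (x k)) => u [n Gu].
  apply: lspan_sub; exists n => j; rewrite ffunE; case: eqP => // _.
  exact: (scaled_sub Gth n).1.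
- by apply/ffunP => k; rewrite !ffunE (scaledE Gth _ (Gx k)).
Qed.

Lemma pow_grading0 : (forall u, G 0%N u -> u = 0) ->
  forall x, pow_grading (d := d) G 0 x -> x = 0.
Proof. by move=> G0 x Gx; apply/ffunP => k; rewrite ffunE; exact: G0. Qed.

End Power.

Section Symmetric.

HB.instance Definition _ (W : lmodType K) :=
  GRing.isLinear.Build K W (Sym W) _ (@sgen K W) (@sgen_linear K W).

Variable W : lmodType K.

Definition sym_map (f : {linear W -> W}) : {lrmorphism Sym W -> Sym W} :=
  sym_lift (@sgen K W \o f).

Variables (G : nat -> set W) (theta : K -> {linear W -> W}).
Hypothesis Gth : scaled_by G theta.

Lemma sym_gradingM n k (x y : Sym W) :
  sym_grading G n x -> sym_grading G k y -> sym_grading G (n + k) (x * y).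
Proof.
apply: (lspan_numul (A := Sym W)) => _ _ [v nv ->] [v' kv' ->].
by apply: lspan_sub; exists (v ++ v'); [exact: sdeg_cat|exact: swordM].
Qed.

Lemma sym_grading1 : sym_grading G 0 (1 : Sym W).
Proof. by apply: lspan_sub; exists [::] => //; constructor. Qed.

Lemma sym_scaled_by :
  scaled_by (sym_grading G) (fun c => sym_map (theta c) : {linear Sym W -> Sym W}).
Proof.
split=> [n|u|c n u]; first exact: lspan_subspace.
- elim/Sym_ind: u => [|s|p q|c p]; first by left.
  + elim: s => [|w s IH].
      by apply: lspan_sub; exists 0%N; exact: sym_grading1.
    have -> : sword (w :: s) = numul (sgen w) (sword s) by rewrite swordM.
    apply: (lspan_numul (P := homogeneous (sym_grading G))) IH => [x y [n Gx] [k Gy]|].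
      by apply: lspan_sub; exists (n + k)%N; exact: sym_gradingM.
    apply: (lspan_image (f := @sgen K W)) (scaled_span Gth w) => x [n Gx].
    apply: lspan_sub; exists n; apply: lspan_sub; exists [:: x] => //.
    by rewrite -[n]addn0; repeat constructor.
  + exact: lspanD.
  + exact: lspanZ.
- apply: (lspan_eq_on (f := sym_map (theta c)) (g := c ^+ n \*: idfun)).
  move=> _ [w nw ->]; rewrite [LHS]sym_lift_word -[RHS]/(c ^+ n *: sword w) sword_prod.
  elim: nw => [|i k a s Ga _ IH]; first by rewrite !big_nil scale1r.
  rewrite !big_cons IH /= (scaledE Gth _ Ga) linearZ_LR.
  by rewrite -scalerAl -scalerAr scalerA exprD.
Qed.

(** Connectedness: a word of degree 0 is either empty or starts with a letter of degree 0, which is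
    zero. *)
Lemma sym_grading0 : (forall w, G 0%N w -> w = 0) ->
  forall u, sym_grading G 0 u -> exists c, u = c *: 1.
Proof.
move=> G0 u; elim=> [|c x y [s s0 ->] _ [a ->]]; first by exists 0; rewrite scale0r.
have [b ->] : exists b, sword s = b *: 1.
  move: s0; move k0 : 0%N => k s0; case: s0 k0 => [_|i j w t Gw _ /esym/eqP].
    by exists 1; rewrite scale1r.
  rewrite addn_eq0 => /andP[/eqP i0 _]; move: Gw; rewrite i0 => /G0->.
  exists 0; rewrite scale0r sword_prod big_cons linear0 mul0r //.
by exists (c * b + a); rewrite scalerDl scalerA.
Qed.

End Symmetric.

Section Tensor.
Variables (U V : lmodType K) (G : nat -> set U) (H : nat -> set V).
Variables (theta : K -> {linear U -> U}) (eta : K -> {linear V -> V}).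
Hypotheses (Gth : scaled_by G theta) (Heta : scaled_by H eta).

Lemma tens_scaled_by :
  scaled_by (tens_grading G H) (fun c => tmap (theta c) (eta c)).
Proof.
split=> [n|p|c n p]; first exact: lspan_subspace.
- elim/tens_ind: p => [|u v|p q|c p]; first by left.
  + apply: (lspan_bilinear (b := @tpure K U V)) (scaled_span Gth u) (scaled_span Heta v).
    * exact: tpure_linl.
    * exact: tpure_linr.
    * move=> x y [n Gx] [k Hy]; apply: lspan_sub; exists (n + k)%N.
      apply: lspan_sub; exists n, x, y; split=> //; first exact: leq_addr.
      by rewrite addKn.
  + exact: lspanD.
  + exact: lspanZ.
- apply: (lspan_eq_on (f := tmap (theta c) (eta c)) (g := c ^+ n \*: idfun)).
  move=> _ [k [u [v [kn Gu Hv ->]]]].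
  rewrite [LHS]tmapE -[RHS]/(c ^+ n *: tpure u v).
  rewrite (scaledE Gth _ Gu) (scaledE Heta _ Hv) tpureZl.
  (* The eigenvalues [c ^+ k] and [c ^+ (n - k)] multiply to [c ^+ n]. *)
  by rewrite linearZ_LR scalerA -exprD subnKC.
Qed.

End Tensor.
End ScaledConstructions.

(** * Antipodes of connected graded bialgebras *)

Section TensorMaps.
Variable K : fieldType.

Lemma tens_linear_eq3 (U V W X : lmodType K) (f g : {linear tens (tens U V) W -> X}) :
  (forall u v w, f (tpure (tpure u v) w) = g (tpure (tpure u v) w)) -> f =1 g.
Proof.
move=> fg; apply: tens_linear_eq => p w.
apply: (tens_linear_eq (f := f \o @tpure_r K (tens U V) W w)
  (g := g \o @tpure_r K (tens U V) W w)) => u v; exact: fg.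
Qed.

Lemma tmap_comp (U U' U'' V V' V'' : lmodType K) (f : {linear U -> U'})
    (f' : {linear U' -> U''}) (g : {linear V -> V'}) (g' : {linear V' -> V''}) p :
  tmap f' g' (tmap f g p) = tmap (f' \o f) (g' \o g) p.
Proof.
apply: (tens_linear_eq (f := tmap f' g' \o tmap f g)) => u v.
by rewrite -[LHS]/(tmap f' g' (tmap f g (tpure u v))) !tmapE.
Qed.

Lemma eq_tmap (U U' V V' : lmodType K) (f f' : {linear U -> U'})
    (g g' : {linear V -> V'}) : f =1 f' -> g =1 g' -> tmap f g =1 tmap f' g'.
Proof. by move=> /linear_ext-> /linear_ext->. Qed.

Lemma tmapDZl (U U' V V' : lmodType K) (f f' : {linear U -> U'}) c
    (g : {linear V -> V'}) p :
  tmap (f \+ c \*: f') g p = tmap f g p + c *: tmap f' g p.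
Proof.
apply: (tens_linear_eq (g := tmap f g \+ c \*: tmap f' g)) => u v.
rewrite [LHS]tmapE tpureDl tpureZl.
by rewrite -[RHS]/(tmap f g (tpure u v) + c *: tmap f' g (tpure u v)) !tmapE.
Qed.

Lemma tmapDZr (U U' V V' : lmodType K) (f : {linear U -> U'}) c
    (g g' : {linear V -> V'}) p :
  tmap f (g \+ c \*: g') p = tmap f g p + c *: tmap f g' p.
Proof.
apply: (tens_linear_eq (g := tmap f g \+ c \*: tmap f g')) => u v.
rewrite [LHS]tmapE linearD linearZ_LR.
by rewrite -[RHS]/(tmap f g (tpure u v) + c *: tmap f g' (tpure u v)) !tmapE.
Qed.

End TensorMaps.

(** * The convolution algebra and the Neumann series *)

Section Convolution.
Variables (K : fieldType) (B : algType K).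
Variables (comul : {lrmorphism B -> tens B B}) (counit : {lrmorphism B -> K^o}).
Hypothesis Bbi : is_bialgebra comul counit.
Implicit Types f g h : {linear B -> B}.

(** The convolution product; an antipode is a two-sided inverse of [idfun] for it, the unit being
    [conv1]. *)
Definition conv f g : {linear B -> B} := @tmul K B \o (tmap f g \o comul).

Lemma convE f g b : conv f g b = @tmul K B (tmap f g (comul b)).
Proof. by []. Qed.

(** Both sides factor through the iterated comultiplication, where coassociativity reduces the claim
    to associativity of [B] on pure tensors. *)
Lemma convA f g h b : conv (conv f g) h b = conv f (conv g h) b.
Proof.
pose fg : {linear tens B B -> B} := @tmul K B \o tmap f g.
pose gh : {linear tens B B -> B} := @tmul K B \o tmap g h.
rewrite !convE.
have -> : tmap (conv f g) h (comul b) = tmap fg h (tmap comul idfun (comul b)).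
  by rewrite tmap_comp.
have -> : tmap f (conv g h) (comul b) = tmap f gh (tmap idfun comul (comul b)).
  by rewrite tmap_comp.
rewrite -(bialg_coassoc Bbi).
apply: (tens_linear_eq3 (f := @tmul K B \o tmap fg h)
  (g := @tmul K B \o (tmap f gh \o @tassoc K B B B))) => x y z.
rewrite -[LHS]/(@tmul K B (tmap fg h (tpure (tpure x y) z))).
rewrite -[RHS]/(@tmul K B (tmap f gh (@tassoc K B B B (tpure (tpure x y) z)))).
rewrite tassocE !tmapE !tmulE.
have -> : fg (tpure x y) = f x * g y by rewrite /fg /= -tmulE -tmapE.
have -> : gh (tpure y z) = g y * h z by rewrite /gh /= -tmulE -tmapE.
by rewrite mulrA.
Qed.

Lemma alg_unit_linear : linear (fun c : K^o => c%:A : B).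
Proof. by move=> a b c; rewrite scalerDl scalerA. Qed.

Definition alg_unit : {linear K^o -> B} :=
  HB.pack_for {linear K^o -> B} (fun c : K^o => c%:A : B)
    (GRing.isLinear.Build K K^o B _ (fun c : K^o => c%:A : B) alg_unit_linear).

Definition conv1 : {linear B -> B} := alg_unit \o counit.

Lemma conv1E b : conv1 b = (counit b)%:A. Proof. by []. Qed.

Lemma conv1l f b : conv conv1 f b = f b.
Proof.
have E : tmap conv1 f (comul b) = tmap alg_unit f (tmap counit idfun (comul b)).
  by rewrite tmap_comp; apply: eq_tmap.
by rewrite convE E (bialg_counitl Bbi) tmapE tmulE /= scale1r mul1r.
Qed.

Lemma conv1r f b : conv f conv1 b = f b.
Proof.
have E : tmap f conv1 (comul b) = tmap f alg_unit (tmap idfun counit (comul b)).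
  by rewrite tmap_comp; apply: eq_tmap.
by rewrite convE E (bialg_counitr Bbi) tmapE tmulE /= scale1r mulr1.
Qed.

Lemma convDZl f f' c g b : conv (f \+ c \*: f') g b = conv f g b + c *: conv f' g b.
Proof. by rewrite !convE tmapDZl linearD linearZ_LR. Qed.

Lemma convDZr f c g g' b : conv f (g \+ c \*: g') b = conv f g b + c *: conv f g' b.
Proof. by rewrite !convE tmapDZr linearD linearZ_LR. Qed.

(** The projection onto the kernel of the counit, in the form [f + c f'] that [convDZl] and
    [convDZr] expand. *)
Definition augm : {linear B -> B} := idfun \+ (-1) \*: conv1.

Fixpoint augm_pow (k : nat) : {linear B -> B} :=
  if k is k'.+1 then conv (augm_pow k') augm else conv1.

Lemma augm_powSr k b : augm_pow k.+1 b = conv (augm_pow k) idfun b - augm_pow k b.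
Proof. by rewrite [LHS]convDZr scaleN1r conv1r. Qed.

(** Powers are built by multiplying on the right; [augm] commutes with its powers by associativity,
    which serves the other-sided inverse. *)
Lemma augm_powSl k b : augm_pow k.+1 b = conv augm (augm_pow k) b.
Proof.
elim: k b => [|k IH] b; first by rewrite [LHS]conv1l conv1r.
have E : conv (augm_pow k) augm = conv augm (augm_pow k) by apply: linear_ext.
by rewrite -[LHS]/(conv (conv (augm_pow k) augm) augm b) E convA.
Qed.

(* The partial sums of the Neumann series of the convolution inverse of
   [id = conv1 + augm]. *)
Fixpoint neumann (N : nat) : {linear B -> B} :=
  if N is N'.+1 then neumann N' \+ (-1) ^+ N' \*: augm_pow N' else \0.

Lemma neumannS N b : neumann N.+1 b = neumann N b + (-1) ^+ N *: augm_pow N b.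
Proof. by []. Qed.

(** The sum telescopes, since [augm_pow N] convolved with [idfun] is
    [augm_pow N.+1 + augm_pow N]. *)
Lemma neumann_convl N b :
  conv (neumann N) idfun b = conv1 b - (-1) ^+ N *: augm_pow N b.
Proof.
elim: N => [|N IH].
  rewrite scale1r subrr convE; have -> : tmap (neumann 0) idfun (comul b) = 0.
    apply: (tens_linear_eq (f := tmap (neumann 0) idfun) (g := \0)) => u v.
    by rewrite tmapE [LHS]tpure0l.
  by rewrite linear0.
rewrite [LHS]convDZl IH augm_powSr exprS mulN1r scaleNr opprK.
by rewrite scalerBr addrA addrAC.
Qed.

Lemma neumann_convr N b :
  conv idfun (neumann N) b = conv1 b - (-1) ^+ N *: augm_pow N b.
Proof.
elim: N => [|N IH].
  rewrite scale1r subrr convE; have -> : tmap idfun (neumann 0) (comul b) = 0.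
    apply: (tens_linear_eq (f := tmap idfun (neumann 0)) (g := \0)) => u v.
    by rewrite tmapE [LHS]linear0.
  by rewrite linear0.
rewrite [LHS]convDZr IH augm_powSl exprS mulN1r scaleNr opprK.
rewrite [in RHS]convDZl conv1l scaleN1r.
by rewrite scalerBr addrA addrAC.
Qed.

Section ConnectedGraded.
Variable G : nat -> set B.
Hypothesis Gspan : forall b, lspan (homogeneous G) b.
Hypothesis Gconn : forall b, G 0%N b -> exists c, b = c *: 1.
Hypothesis Gcomul : forall n b, G n b -> tens_grading G G n (comul b).

(** In a term [u (x) v] of [comul b] with [u] of degree [i], either [i < k] and induction kills [u],
    or [n <= k <= i] and [v] has degree 0. In the latter case [v] is a scalar, which [augm]
    kills. *)
Lemma augm_pow_homog k n b : G n b -> (n < k)%N -> augm_pow k b = 0.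
Proof.
elim: k n b => [//|k IH] n b Gb nk.
apply: (lspan_eq_on (f := @tmul K B \o tmap (augm_pow k) augm) (g := \0))
  (Gcomul Gb) => _ [i [u [v [le_in Gu Gv ->]]]].
rewrite -[LHS]/(@tmul K B (tmap (augm_pow k) augm (tpure u v))) tmapE tmulE.
rewrite -[RHS]/(0 : B).
have [ik|ki] := ltnP i k; first by rewrite (IH i) ?mul0r.
have [c vE] : exists c, v = c *: 1.
  by apply: Gconn; rewrite (_ : 0%N = (n - i)%N) //; apply/esym/eqP;
     rewrite subn_eq0 (leq_trans _ ki).
suff -> : augm v = 0 by rewrite mulr0.
rewrite -[augm v]/(v + (-1) *: (counit v)%:A) vE.
have -> : counit (c *: 1) = c.
  by rewrite [LHS]linearZ_LR [X in c *: X](rmorph1 counit); exact: mulr1.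
by rewrite scaleN1r subrr.
Qed.

Lemma augm_pow_eventually b : exists N, forall k, (N <= k)%N -> augm_pow k b = 0.
Proof.
elim: (Gspan b) => [|c x y [n Gx] _ [N HN]].
  by exists 0%N => k _; rewrite linear0.
exists (maxn n.+1 N) => k; rewrite geq_max => /andP[nk Nk].
by rewrite linearP HN // (augm_pow_homog Gx nk) scaler0 addr0.
Qed.

Lemma connected_antipode : exists S, is_antipode comul counit S.
Proof.
have ex b : exists v, exists N, forall M, (N <= M)%N -> neumann M b = v.
  have [N HN] := augm_pow_eventually b; exists (neumann N b), N => M.
  elim: M => [|M IH]; first by rewrite leqn0 => /eqP->.
  rewrite leq_eqVlt => /orP[/eqP->//|NM].
  by rewrite neumannS HN // scaler0 addr0 IH.
pose S b := sval (cid (ex b)).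
have SP b : exists N, forall M, (N <= M)%N -> neumann M b = S b.
  exact: svalP (cid (ex b)).
have S_lin : linear S.
  move=> c x y; have [N1 H1] := SP (c *: x + y).
  have [N2 H2] := SP x; have [N3 H3] := SP y.
  pose M := maxn N1 (maxn N2 N3).
  rewrite -(H1 M) ?leq_maxl // linearP (H2 M) ?(H3 M) //.
    by rewrite /M !leq_max leqnn !orbT.
  by rewrite /M !leq_max leqnn !orbT.
pose SL := HB.pack_for {linear B -> B} S (GRing.isLinear.Build K B B _ S S_lin).
(* The stage at which [neumann M] reaches [S] depends on the vector; a tensor involves finitely many
   vectors, so one stage serves for all of it. *)
have tens_ev (f : {linear B -> B} -> {linear tens B B -> tens B B}) :
    (forall u v, exists N, forall M, (N <= M)%N ->
      f SL (tpure u v) = f (neumann M) (tpure u v)) ->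
    forall p, exists N, forall M, (N <= M)%N -> f SL p = f (neumann M) p.
  move=> fH; elim/tens_ind => [||p q [N HN] [N' HN']|c p [N HN]] //.
  - by exists 0%N => M _; rewrite !linear0.
  - exists (maxn N N') => M; rewrite geq_max => /andP[NM N'M].
    by rewrite !linearD (HN M) // (HN' M).
  - by exists N => M NM; rewrite !linearZ_LR (HN M).
exists SL => b; rewrite -!convE -conv1E; have [N0 HN0] := augm_pow_eventually b.
split.
- have [u v|N HN] := tens_ev (fun f => tmap f idfun) _ (comul b).
    have [N HN] := SP u; exists N => M NM.
    by rewrite !tmapE -[SL u]/(S u) -(HN M NM).
  (* Beyond [N] the partial sum replaces [S]; beyond [N0] the remainder of the telescoped sum
     vanishes. *)
  rewrite convE (HN (maxn N0 N)) ?leq_maxr // -convE neumann_convl.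
  by rewrite HN0 ?leq_maxl // scaler0 subr0.
- have [u v|N HN] := tens_ev (fun f => tmap idfun f) _ (comul b).
    have [N HN] := SP v; exists N => M NM.
    by rewrite !tmapE -[SL v]/(S v) -(HN M NM).
  rewrite convE (HN (maxn N0 N)) ?leq_maxr // -convE neumann_convr.
  by rewrite HN0 ?leq_maxl // scaler0 subr0.
Qed.

End ConnectedGraded.
End Convolution.

(** * The bialgebra of a universal product *)

Section ConvolutionOfFunctionals.
Variable K : fieldType.
Hypothesis Kinf : forall p : {poly K}, (forall x, p.[x] = 0) -> p = 0.

(** * Coalgebra identities tested on characters *)

Section TensorFunctionals.

Lemma separating1 : separating [set (idfun : {linear K^o -> K^o})]%classic.
Proof. by move=> u /(_ idfun); apply. Qed.

Lemma separating_eq (U : lmodType K) (F : set {linear U -> K^o}) u v :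
  separating F -> (forall f, F f -> f u = f v) -> u = v.
Proof.
move=> sepF fuv; apply/eqP; rewrite -subr_eq0; apply/eqP; apply: sepF => f Ff.
by rewrite linearB fuv // subrr.
Qed.

Lemma tprod_tmap (U U' V V' : lmodType K) (f : {linear U' -> K^o})
    (g : {linear V' -> K^o}) (a : {linear U -> U'}) (b : {linear V -> V'}) p :
  tprod f g (tmap a b p) = tprod (f \o a) (g \o b) p.
Proof. by rewrite -[LHS]/(@tmul K K^o (tmap f g (tmap a b p))) tmap_comp. Qed.

Lemma tprod_tassoc (U V W : lmodType K) (f : {linear U -> K^o})
    (g : {linear V -> K^o}) (h : {linear W -> K^o}) p :
  tprod f (tprod g h) (@tassoc K U V W p) = tprod (tprod f g) h p.
Proof.
apply: (tens_linear_eq3 (f := tprod f (tprod g h) \o @tassoc K U V W)) => u v w.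
rewrite -[LHS]/(tprod f (tprod g h) (@tassoc K U V W (tpure (tpure u v) w))).
by rewrite tassocE !tprodE mulrA.
Qed.

Lemma tprodM (A B : algType K) (f : {linear A -> K^o}) (g : {linear B -> K^o}) p q :
  (forall x y, f (x * y) = f x * f y) -> (forall x y, g (x * y) = g x * g y) ->
  tprod f g (p * q) = tprod f g p * tprod f g q.
Proof.
move=> fM gM; elim/tens_ind: p => [|x y|p p' Hp Hp'|c p Hp].
- by rewrite mul0r !linear0 mul0r.
- elim/tens_ind: q => [|x' y'|q q' Hq Hq'|c q Hq].
  + by rewrite mulr0 !linear0 mulr0.
  + by rewrite [X in tprod f g X]tensmulE !tprodE fM gM mulrACA.
  + by rewrite mulrDr !linearD Hq Hq' mulrDr.
  + by rewrite -scalerAr !linearZ_LR Hq; exact: mulrCA.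
- by rewrite mulrDl !linearD Hp Hp' mulrDl.
- by rewrite -scalerAl !linearZ_LR Hp; exact: mulrA.
Qed.

Lemma sym_char_eq (W : lmodType K) (F G : {linear Sym W -> K^o}) :
  F 1 = 1 -> G 1 = 1 ->
  (forall x y, F (x * y) = F x * F y) -> (forall x y, G (x * y) = G x * G y) ->
  (forall w, F (sgen w) = G (sgen w)) -> F =1 G.
Proof.
move=> F1 G1 FM GM FG; elim/Sym_ind => [|s|p q Hp Hq|c p Hp].
- by rewrite !linear0.
- rewrite sword_prod; elim: s => [|w s IH]; first by rewrite !big_nil F1 G1.
  by rewrite !big_cons FM GM FG IH.
- by rewrite !linearD Hp Hq.
- by rewrite !linearZ_LR Hp.
Qed.

(** Both sides are characters of [Sym W], the left one because a product of characters is a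
    character of the tensor product, and they agree on generators. *)
Lemma tprod_sym_lift (W U V : lmodType K) (f : {linear U -> K^o})
    (g : {linear V -> K^o}) (h : {linear W -> K^o})
    (tau : {linear W -> tens (Sym U) (Sym V)}) b :
  (forall w, h w = tprod (symev f) (symev g) (tau w)) ->
  tprod (symev f) (symev g) (sym_lift tau b) = symev h b.
Proof.
move=> hE; set t := sym_lift tau.
pose F : {linear Sym W -> K^o} := tprod (symev f) (symev g) \o t.
have FE x : F x = tprod (symev f) (symev g) (t x) by [].
rewrite -FE; apply: sym_char_eq.
- by rewrite FE (rmorph1 t) [LHS]tprodE !symev1 mulr1.
- exact: symev1.
- move=> x y; rewrite !FE (rmorphM t).
  by apply: tprodM => ? ?; exact: symevM.
- exact: symevM.
- by move=> w; rewrite FE [t _]sym_liftE symevE hE.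
Qed.

Section SeparatedBialgebra.
Variables (B : algType K) (comul : {lrmorphism B -> tens B B}).
Variables (X : Type) (ev : X -> {linear B -> K^o}) (mul : X -> X -> X).
Hypothesis sep : separating (range ev).
Hypothesis evM : forall x y b, tprod (ev x) (ev y) (comul b) = ev (mul x y) b.

Lemma tprod_comul x y : tprod (ev x) (ev y) \o comul = ev (mul x y) :> {linear B -> K^o}.
Proof. by apply: linear_ext => b; exact: evM. Qed.

(** On products of the functionals [ev x], coassociativity and the counit laws turn into the monoid
    laws of [mul], by [evM]. *)
Lemma separated_bialgebra (counit : {lrmorphism B -> K^o}) (e : X) :
  (forall b, counit b = ev e b) ->
  associative mul -> left_id e mul -> right_id e mul ->
  is_bialgebra comul counit.
Proof.
move=> ev0 mulXA mul0X mulX0.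
have evid x : ev x \o idfun = ev x :> {linear B -> K^o} by exact: linear_ext.
have eve : idfun \o counit = ev e :> {linear B -> K^o} by exact: linear_ext.
split=> b.
- apply: (separating_eq (tens_separating sep (tens_separating sep sep))).
  move=> _ [_ [_ [[x _ <-] [_ [_ [[y _ <-] [z _ <-] ->]]] ->]]].
  rewrite tprod_tassoc !tprod_tmap !tprod_comul !evid !evM.
  by rewrite mulXA.
- apply: (separating_eq (tens_separating separating1 sep)).
  move=> _ [_ [_ [-> [x _ <-] ->]]].
  by rewrite tprod_tmap tprodE eve evid evM mul0X mul1r.
- apply: (separating_eq (tens_separating sep separating1)).
  move=> _ [_ [_ [[x _ <-] -> ->]]].
  by rewrite tprod_tmap tprodE eve evid evM mulX0 mulr1.
Qed.

Lemma separated_comul_morph (s : {linear B -> B}) (pull : X -> X) b :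
  (forall x c, ev (pull x) c = ev x (s c)) ->
  (forall x y, mul (pull x) (pull y) = pull (mul x y)) ->
  tmap s s (comul b) = comul (s b).
Proof.
move=> evs mul_pull; apply: (separating_eq (tens_separating sep sep)).
move=> _ [_ [_ [[x _ <-] [y _ <-] ->]]].
have E z : ev z \o s = ev (pull z) :> {linear B -> K^o}.
  by apply: linear_ext => c; rewrite evs.
by rewrite tprod_tmap !E !evM mul_pull evs.
Qed.

End SeparatedBialgebra.

End TensorFunctionals.

(** * Tuples of functionals *)

Section DDual.
Variable d : nat.

Lemma ddual_ext (A : lmodType K) (phi psi : ddual d A) :
  (forall k x, phi k x = psi k x) -> phi = psi.
Proof. by move=> pq; apply: funext => k; apply: linear_ext. Qed.

Lemma dpull_id (A : nualgType K) (phi : ddual d A) : dpull phi (nuid A) = phi.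
Proof. exact: ddual_ext. Qed.

Lemma dfun_dpull (A B : nualgType K) (phi : ddual d A) (j : nuhom B A) x :
  dfun phi (powmap j x) = dfun (dpull phi j) x.
Proof. by apply: eq_bigr => k _; rewrite ffunE. Qed.

(** Restriction to the coordinates identifies the dual of [A^d] with the [d]-tuples of functionals
    on [A], so the characters coming from such tuples are all the [symev f]. *)
Lemma linear_dfun (A : lmodType K) (f : {linear {ffun 'I_d -> A} -> K^o}) :
  f = dfun (fun k => f \o pow_in k).
Proof.
apply: linear_ext => x; rewrite {1}[x]pow_in_sum linear_sum.
by apply: eq_bigr.
Qed.

Lemma dsym_separating (A : lmodType K) :
  separating (range (fun phi : ddual d A => symev (dfun phi))).
Proof.
move=> u Hu; apply: (sym_separating Kinf) => _ [f _ <-].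
by rewrite [f]linear_dfun; apply: Hu; exists (fun k => f \o pow_in k).
Qed.

Lemma symev_powmap (A B : nualgType K) (phi : ddual d A) (j : nuhom B A) b :
  symev (dfun (dpull phi j)) b =
  symev (dfun phi) (sym_lift (@sgen K _ \o powmap j) b).
Proof.
pose h := sym_lift (@sgen K {ffun 'I_d -> A} \o powmap j).
pose G : {linear Sym {ffun 'I_d -> B} -> K^o} := symev (dfun phi) \o h.
suff : symev (dfun (dpull phi j)) =1 G by exact.
apply: sym_char_eq.
- exact: symev1.
- by rewrite -[LHS]/(symev (dfun phi) (h 1)) (rmorph1 h) symev1.
- exact: symevM.
- move=> x y; rewrite -[LHS]/(symev (dfun phi) (h (x * y))) (rmorphM h).
  exact: symevM.
- move=> w; rewrite -[RHS]/(symev (dfun phi) (h (sgen w))) sym_liftE.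
  by rewrite !symevE; exact/esym/dfun_dpull.
Qed.

End DDual.

(** * Face-preserving homomorphisms *)

Section FacedHoms.
Variable m : nat.

Lemma face_hom_id (A : facedAlg K m) : face_hom (nuid A : nuhom A A).
Proof. by []. Qed.

Lemma nuzero_linear (A B : nualgType K) : linear (fun _ : A => 0 : B).
Proof. by move=> c x y; rewrite scaler0 addr0. Qed.

(** A homomorphism because no unit has to be preserved; it plays the part of a counit for
    [Delta_m]. *)
Definition nuzero (A B : nualgType K) : nuhom A B :=
  NUHom (@nuzero_linear A B) (fun _ _ => esym (numul0l 0)).

Lemma face_hom_zero (A B : facedAlg K m) : face_hom (nuzero A B : nuhom A B).
Proof. by move=> l x _; exact: (sa_submod (fa_face B l)).1. Qed.

Lemma face_hom_copies (B : 'I_m -> nualgType K) (A : facedAlg K m)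
    (j : nuhom (faced_copies B) A) :
  (forall l y, j (fin B l y) \in sa_pred (fa_face A l)) -> face_hom j.
Proof. by move=> jB l x /asboolP[y ->]; exact: jB. Qed.

Lemma map2_in1 (A1 A2 B1 B2 : nualgType K) (f1 : nuhom A1 B1)
    (f2 : nuhom A2 B2) a : map2 f1 f2 (in1 A1 A2 a) = in1 B1 B2 (f1 a).
Proof. exact: case2_in1. Qed.

Lemma map2_in2 (A1 A2 B1 B2 : nualgType K) (f1 : nuhom A1 B1)
    (f2 : nuhom A2 B2) a : map2 f1 f2 (in2 A1 A2 a) = in2 B1 B2 (f2 a).
Proof. exact: case2_in2. Qed.

Lemma map2_comp (A1 A2 B1 B2 C1 C2 : nualgType K) (f1 : nuhom A1 B1)
    (f2 : nuhom A2 B2) (g1 : nuhom B1 C1) (g2 : nuhom B2 C2) x :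
  map2 g1 g2 (map2 f1 f2 x) = map2 (nucomp g1 f1) (nucomp g2 f2) x.
Proof.
apply: (fprod2_hom_eq (f := nucomp (map2 g1 g2) (map2 f1 f2))) => a.
  by rewrite nucompE !map2_in1.
by rewrite nucompE !map2_in2.
Qed.

Lemma eq_map2 (A1 A2 B1 B2 : nualgType K) (f1 g1 : nuhom A1 B1)
    (f2 g2 : nuhom A2 B2) :
  f1 =1 g1 -> f2 =1 g2 -> map2 f1 f2 =1 map2 g1 g2.
Proof.
move=> fg1 fg2; apply: fprod2_hom_eq => a; first by rewrite !map2_in1 fg1.
by rewrite !map2_in2 fg2.
Qed.

End FacedHoms.

Lemma nuhomD (A B : nualgType K) (f : nuhom A B) x y : f (x + y) = f x + f y.
Proof. exact: linearD. Qed.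

Lemma nuhom0 (A B : nualgType K) (f : nuhom A B) : f 0 = 0.
Proof. exact: linear0. Qed.

(** * The diagonal map of [D] *)

Section DiagonalMap.
Variables (m : nat) (V : lmodType K).
Let D := Dalg m V.

(** [D] is generated by the [m] copies of [V], whose elements are primitive for [Delta_m]; the
    identities for [Delta_m] are checked there. *)
Lemma Dalg_hom_eq (B : nualgType K) (f g : nuhom D B) :
  (forall l v, f (Dcopy V l (tgen v)) = g (Dcopy V l (tgen v))) -> f =1 g.
Proof.
move=> fg; apply: fprod_hom_eq => l; apply: (tensalg_hom_eq
  (f := nucomp f (Dcopy V l)) (g := nucomp g (Dcopy V l))) => v.
exact: fg.
Qed.

Lemma Delta_m_gen l v :
  let x := Dcopy V l (tgen v) in Delta_m m V x = in1 D D x + in2 D D x.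
Proof.
move=> x; rewrite [LHS]fcaseE nucompE tensalg_liftE.
rewrite -[Delta_gen V v]/(in1 (tensalg V) (tensalg V) (tgen v) +
                          in2 (tensalg V) (tensalg V) (tgen v)).
by rewrite nuhomD map2_in1 map2_in2.
Qed.

(** Universality speaks of face-preserving homomorphisms only, hence this check before it is applied
    to [Delta_m]. *)
Lemma Delta_m_face : face_hom (Delta_m m V : nuhom D (faced_prod D D)).
Proof.
apply: face_hom_copies => l y; rewrite /Delta_m fcaseE; apply/asboolP.
pose cr := corestr (fin (fun _ : 'I_m => tensalg V) l).
(* The corestrictions land in the faces of the two factors; composing with the inclusions gives back
   [Dcopy l] on each. *)
by exists (map2 cr cr (Delta V y)); rewrite [RHS]map2_comp; exact: eq_map2.
Qed.

Lemma Delta_m_coassoc x :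
  assoc_map D D D (map2 (Delta_m m V) (nuid D) (Delta_m m V x)) =
  map2 (nuid D) (Delta_m m V) (Delta_m m V x).
Proof.
apply: (Dalg_hom_eq
  (f := nucomp (assoc_map D D D) (nucomp (map2 (Delta_m m V) (nuid D)) (Delta_m m V)))
  (g := nucomp (map2 (nuid D) (Delta_m m V)) (Delta_m m V))) => l v.
rewrite !nucompE Delta_m_gen !nuhomD !map2_in1 !map2_in2 Delta_m_gen !nuhomD.
by rewrite /assoc_map !case2_in1 !case2_in2 !nucompE addrA.
Qed.

Lemma Delta_m_counitl x : map2 (nuzero D D) (nuid D) (Delta_m m V x) = in2 D D x.
Proof.
apply: (Dalg_hom_eq (f := nucomp (map2 (nuzero D D) (nuid D)) (Delta_m m V))) => l v.
by rewrite nucompE Delta_m_gen nuhomD map2_in1 map2_in2 nuhom0 add0r.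
Qed.

Lemma Delta_m_counitr x : map2 (nuid D) (nuzero D D) (Delta_m m V x) = in1 D D x.
Proof.
apply: (Dalg_hom_eq (f := nucomp (map2 (nuid D) (nuzero D D)) (Delta_m m V))) => l v.
by rewrite nucompE Delta_m_gen nuhomD map2_in1 map2_in2 nuhom0 addr0.
Qed.

Definition Dscale (f : {linear V -> V}) : nuhom D D :=
  fmap (fun _ : 'I_m => tensalg_map f).

Lemma Dscale_face f : face_hom (Dscale f).
Proof.
apply: face_hom_copies => l y; rewrite /Dscale /fmap fcaseE; apply/asboolP.
by exists (tensalg_map f y).
Qed.

Lemma Delta_m_Dscale f x :
  map2 (Dscale f) (Dscale f) (Delta_m m V x) = Delta_m m V (Dscale f x).
Proof.
apply: (Dalg_hom_eq (f := nucomp (map2 (Dscale f) (Dscale f)) (Delta_m m V))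
  (g := nucomp (Delta_m m V) (Dscale f))) => l v.
have DE : Dscale f (Dcopy V l (tgen v)) = Dcopy V l (tgen (f v)).
  by rewrite [LHS]fcaseE nucompE tensalg_map_gen.
by rewrite !nucompE Delta_m_gen nuhomD map2_in1 map2_in2 DE Delta_m_gen.
Qed.

End DiagonalMap.

(** * The dual product [star] and the graded bialgebra *)

Section Bialgebra.
Variables (d m : nat) (odot : fprod_op K d m).
Hypothesis hodot : is_uau odot.
Variable V : lmodType K.
Let D := Dalg m V.
Let W := {ffun 'I_d -> D}.
Variable sigma : {linear {ffun 'I_d -> fprod2 D D} -> tens (Sym W) (Sym W)}.
Hypothesis hsigma : is_sigma odot sigma.

Definition star (phi psi : ddual d D) : ddual d D :=
  dpull (@odot D D phi psi) (Delta_m m V).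

(** Universality moves pullbacks from the functionals to the argument, so laws of [star] become
    identities for [Delta_m]. *)
Lemma odot_pull (A1 A2 : facedAlg K m) (j1 : nuhom D A1) (j2 : nuhom D A2)
    (phi1 : ddual d A1) (phi2 : ddual d A2) k x :
  face_hom j1 -> face_hom j2 ->
  star (dpull phi1 j1) (dpull phi2 j2) k x =
  @odot A1 A2 phi1 phi2 k (map2 j1 j2 (Delta_m m V x)).
Proof. by move=> f1 f2; rewrite (uau_universal hodot f1 f2). Qed.

Lemma starA : associative star.
Proof.
move=> phi1 phi2 phi3; apply/esym/ddual_ext => k x.
(* Trivial pullbacks are inserted because [odot_pull] expects one in each factor. *)
rewrite -[phi3 in LHS]dpull_id -[phi1 in RHS]dpull_id.
rewrite /(star phi1 phi2) /(star phi2 phi3).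
rewrite (odot_pull (A1 := faced_prod D D) (A2 := D) (j1 := Delta_m m V)
  (j2 := nuid D)); [|exact: Delta_m_face|exact: face_hom_id].
rewrite (odot_pull (A1 := D) (A2 := faced_prod D D) (j1 := nuid D)
  (j2 := Delta_m m V)); [|exact: face_hom_id|exact: Delta_m_face].
by rewrite (uau_associative hodot) Delta_m_coassoc.
Qed.

Definition dzero : ddual d D := fun _ => \0.

Lemma dzero_pull : dpull dzero (nuzero D D) = dzero.
Proof. exact: ddual_ext. Qed.

Lemma star0l phi : star dzero phi = phi.
Proof.
(* As [dzero] is its own pullback along [nuzero], the first leg of [Delta_m] collapses and unitality
   of the product applies. *)
apply: ddual_ext => k x; rewrite -{1}dzero_pull -{1}[phi]dpull_id.
rewrite (odot_pull (A1 := D) (A2 := D)); [|exact: face_hom_zero|exact: face_hom_id].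
by rewrite Delta_m_counitl (uau_unital hodot dzero phi k).2.
Qed.

Lemma star0r phi : star phi dzero = phi.
Proof.
apply: ddual_ext => k x; rewrite -{1}dzero_pull -{1}[phi]dpull_id.
rewrite (odot_pull (A1 := D) (A2 := D)); [|exact: face_hom_id|exact: face_hom_zero].
by rewrite Delta_m_counitr (uau_unital hodot phi dzero k).1.
Qed.

Lemma star_Dscale f phi psi :
  star (dpull phi (Dscale m f)) (dpull psi (Dscale m f)) =
  dpull (star phi psi) (Dscale m f).
Proof.
apply: ddual_ext => k x.
rewrite (odot_pull (A1 := D) (A2 := D)); try exact: Dscale_face.
by rewrite Delta_m_Dscale.
Qed.

Notation ev phi := (symev (dfun phi) : {linear Sym W -> K^o}).
Notation comul := (Lcomul sigma).

(** On generators this is the defining property of [sigma]; both sides being multiplicative, it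
    extends to the symmetric algebra. *)
Lemma ev_comul phi psi b :
  tprod (ev phi) (ev psi) (comul b) = ev (star phi psi) b.
Proof.
apply: tprod_sym_lift => w.
apply: etrans (esym (dfun_dpull (@odot D D phi psi) (Delta_m m V) w)) _.
exact: hsigma.
Qed.

Lemma L_bialgebra : is_bialgebra comul (Lcounit d m V).
Proof.
apply: (@separated_bialgebra (Sym W) comul (ddual d D)
  (fun phi => ev phi) star _ _ (Lcounit d m V) dzero).
- exact: dsym_separating.
- exact: ev_comul.
- move=> b; have -> // : dfun dzero = \0 :> {linear W -> K^o}.
  by apply: linear_ext => x; exact: big1.
- exact: starA.
- exact: star0l.
- exact: star0r.
Qed.

Definition Lscale (f : {linear V -> V}) : {lrmorphism Sym W -> Sym W} :=
  sym_map (powmap (d := d) (Dscale m f)).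

(** For [f = theta c] this says that [comul] commutes with the scaling operators, hence preserves
    degree. *)
Lemma comul_Lscale f b :
  tmap (Lscale f) (Lscale f) (comul b) = comul (Lscale f b).
Proof.
apply: (@separated_comul_morph (Sym W) comul (ddual d D)
  (fun phi => ev phi) star _ _ (Lscale f) (fun phi => dpull phi (Dscale m f))).
- exact: dsym_separating.
- exact: ev_comul.
- by move=> phi x; rewrite symev_powmap.
- exact: star_Dscale.
Qed.

Variable GV : nat -> set V.
Hypothesis hGV : is_pos_grading GV.

Lemma Lgrading_scaled_by : exists theta,
  scaled_by (Lgrading (d := d) (m := m) GV)
    (fun c => Lscale (theta c) : {linear Sym W -> Sym W}).
Proof.
have [theta Gth] := grading_scaled_by hGV.1; exists theta.
apply: sym_scaled_by; apply: pow_scaled_by.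
apply: (fprod_scaled_by (theta := fun _ c => tensalg_map (theta c))) => _.
exact: tensalg_scaled_by.
Qed.

Lemma Lgrading0 b : Lgrading (d := d) (m := m) GV 0 b -> exists c, b = c *: 1.
Proof.
apply: sym_grading0; apply: pow_grading0; apply: fprod_grading0 => _.
apply: tensalg_grading0; exact: hGV.2.
Qed.

Lemma L_graded_hopf : is_graded_hopf comul (Lcounit d m V) (Lgrading GV).
Proof.
have [theta Gth] := Lgrading_scaled_by.
have Gcomul n b : Lgrading (d := d) (m := m) GV n b ->
    tens_grading (Lgrading GV) (Lgrading GV) n (comul b).
  move=> Gb; apply: (scaled_by_homogeneous Kinf (tens_scaled_by Gth Gth)) => c.
  by rewrite comul_Lscale (scaledE Gth _ Gb) linearZ_LR.
split=> //.
- split; first exact: L_bialgebra.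
  apply: (connected_antipode L_bialgebra (scaled_span Gth) Lgrading0 Gcomul).
- split; first exact: scaled_by_grading Kinf _ _ _ Gth.
  + exact: sym_grading1.
  + exact: sym_gradingM.
Qed.

End Bialgebra.
End ConvolutionOfFunctionals.

(** * Vanishing polynomials in characteristic zero, and the complex case *)

Lemma char0_poly_eq0 (K : numFieldType) (p : {poly K}) :
  (forall x, p.[x] = 0) -> p = 0.
Proof.
move=> p0; apply/eqP; apply: contraT => pn0.
(* The naturals below [size p] are distinct roots in characteristic zero, one more than the degree
   allows. *)
have := @max_poly_roots K p [seq n%:R | n <- iota 0 (size p)] pn0.
rewrite size_map size_iota ltnn => -> //.
  by apply/allP => x _; rewrite rootE p0.
rewrite map_inj_uniq ?iota_uniq // => i j /eqP; by rewrite Num.Theory.eqr_nat => /eqP.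
Qed.

Unset Implicit Arguments.

Theorem theorem6p3 (R : realType) (d m : nat) (hd : (0 < d)%N) (hm : (0 < m)%N)
    (odot : fprod_op (complex R) d m) (hodot : is_uau odot)
    (V : lmodType (complex R)) (GV : nat -> set V) (hGV : is_pos_grading GV)
    (sigma : {linear {ffun 'I_d -> fprod2 (Dalg m V) (Dalg m V)} ->
                tens (Sym {ffun 'I_d -> Dalg m V}) (Sym {ffun 'I_d -> Dalg m V})})
    (hsigma : is_sigma odot sigma) :
  is_graded_hopf (Lcomul sigma) (Lcounit d m V) (Lgrading GV).
Proof.
exact: (L_graded_hopf (@char0_poly_eq0 (complex R : numFieldType)) hodot hsigma hGV).
Qed.
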